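(* There exist universal constants $c_1,c_2>0$ such that for every $n$, every $0$-symmetric convex body $K$ in $\mathbb{R}^n$ of volume $1$, every $\delta\in(0,1/e]$ and every $\theta\in S^{n-1}$, $$c_1\,h_{Z_{\log(1/\delta)}(K)}(\theta)\le h_{K_\delta}(\theta)\le c_2\,h_{Z_{\log(1/\delta)}(K)}(\theta),$$ or, equivalently, $$c_1\,Z_{\log(1/\delta)}(K)\subseteq K_\delta\subseteq c_2\,Z_{\log(1/\delta)}(K).$$ Consequently, $$\frac1{c_1}Z^\circ_{\log(1/\delta)}(K)\supseteq K_\delta^\circ\supseteq\frac1{c_2}Z^\circ_{\log(1/\delta)}(K).$$
   Context: A convex body is a compact convex set with non-empty interior; $0$-symmetric means $K=-K$; $|\cdot|$ is volume; $h_C(\theta)=\max_{y\in C}\langle\theta,y\rangle$ is the support function and $C^\circ=\{y:\langle x,y\rangle\le1\ \forall x\in C\}$ the polar of $C$. For $|K|=1$ and $1\le p<\infty$, the $L_p$ centroid body $Z_p(K)$ is the convex body with support function $h_{Z_p(K)}(\theta)=\left(\int_K|\langle x,\theta\rangle|^p\,dx\right)^{1/p}$, and $Z_p^\circ(K)$ is its polar. For $K$ symmetric of volume $1$ and $\delta\in(0,1)$, the floating body is $$K_\delta=\bigcap_{\theta\in S^{n-1}}\{x\in K:|\langle x,\theta\rangle|\le t_\theta\},\qquad t_\theta=\sup\{t>0:|\{x\in K:|\langle x,\theta\rangle|\le t\}|=1-\delta\}.$$ *)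

(* Defs.v *)
From HB Require Import structures.
From mathcomp Require Import all_boot all_order all_algebra.
From mathcomp Require Import all_classical all_reals all_analysis.

Set Implicit Arguments.
Unset Strict Implicit.
Unset Printing Implicit Defensive.

Import Order.TTheory GRing.Theory Num.Theory.
Import numFieldNormedType.Exports.

Local Open Scope classical_set_scope.
Local Open Scope ring_scope.

(* R^n is 'rV[R]_n.  Its sigma-algebra is the one generated by the coordinate
   maps, as in the library's instance for n.-tuple; its topology is the
   library's one (sup norm). *)
Definition rV_display : measure_display.
Proof. exact: default_measure_display. Qed.

Section measurable_rV.
Context {R : realType} (n : nat).

Definition rV_coord (i : 'I_n) (v : 'rV[R]_n) : R := v ord0 i.

Let rV_set0 : g_sigma_preimage rV_coord set0.
Proof. exact: sigma_algebra0. Qed.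

Let rV_setC A : g_sigma_preimage rV_coord A -> g_sigma_preimage rV_coord (~` A).
Proof. exact: sigma_algebraC. Qed.

Let rV_bigcup (F : (set 'rV[R]_n)^nat) :
  (forall i, g_sigma_preimage rV_coord (F i)) ->
  g_sigma_preimage rV_coord (\bigcup_i (F i)).
Proof. exact: sigma_algebra_bigcup. Qed.

HB.instance Definition rV_isMeasurable := @isMeasurable.Build rV_display
  'rV[R]_n (g_sigma_preimage rV_coord) rV_set0 rV_setC rV_bigcup.

Lemma measurable_rV_coord (i : 'I_n) : measurable_fun [set: 'rV[R]_n] (rV_coord i).
Proof.
move=> _ Y mY; rewrite setTI; apply: sub_sigma_algebra => /=.
rewrite -bigcup_seq/=; exists i => /=; first by rewrite mem_index_enum.
by exists Y => //; rewrite setTI.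
Qed.

Lemma measurable_fun_rVP d (T : measurableType d) (f : T -> 'rV[R]_n) :
  (forall i, measurable_fun [set: T] (rV_coord i \o f)) ->
  measurable_fun [set: T] f.
Proof.
move=> mf _ A; pose G := image_set_system [set: T] f measurable.
suff sub : g_sigma_preimage rV_coord `<=` G by exact: sub.
apply: smallest_sub; first exact/sigma_algebra_image/sigma_algebra_measurable.
rewrite -bigcup_seq; apply: bigcup_sub => i _ _ [B mB <-].
by rewrite /G /image_set_system/= !setTI -[X in measurable X]setTI; exact: mf.
Qed.

End measurable_rV.

Section lebesgue_rV_step.
Context {R : realType} (n : nat).

Definition rV_cons (p : measurableTypeR R * 'rV[R]_n) : 'rV[R]_n.+1 :=
  row_mx (p.1 : R)%:M p.2.

Lemma rV_cons0 p : rV_cons p ord0 ord0 = p.1.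
Proof.
rewrite mxE; case: splitP => // j _.
by rewrite !mxE !ord1 eqxx mulr1n.
Qed.

Lemma rV_consS p (j : 'I_n) : rV_cons p ord0 (lift ord0 j) = p.2 ord0 j.
Proof.
rewrite mxE; case: splitP => [[[|]]//|k /= jk].
by congr (p.2 _ _); apply/val_inj; move: jk; rewrite /= /bump/= !add1n => -[].
Qed.

Lemma measurable_rV_cons : measurable_fun [set: _ * _] rV_cons.
Proof.
apply: measurable_fun_rVP => i.
case: (unliftP ord0 i) => [j|] ->.
- rewrite (_ : _ \o _ = rV_coord j \o snd).
    by apply: measurableT_comp => //; exact: measurable_rV_coord.
  by apply/funext => p /=; rewrite /rV_coord rV_consS.
- rewrite (_ : _ \o _ = fst); first exact: measurable_fst.
  by apply/funext => p /=; rewrite /rV_coord rV_cons0.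
Qed.

Variable m : {sigma_finite_measure set 'rV[R]_n -> \bar R}.

Definition lebesgue_rV_step : set 'rV[R]_n.+1 -> \bar R :=
  pushforward (lebesgue_measure \x m)%E rV_cons.

Let step0 : lebesgue_rV_step set0 = 0%E.
Proof. by rewrite /lebesgue_rV_step /pushforward preimage_set0 measure0. Qed.

Let step_ge0 A : (0 <= lebesgue_rV_step A)%E.
Proof. by rewrite /lebesgue_rV_step /pushforward measure_ge0. Qed.

Let step_sigma_additive : semi_sigma_additive lebesgue_rV_step.
Proof.
apply: (@measure_semi_sigma_additive _ _ _
  (pushforward (lebesgue_measure \x m)%E rV_cons)).
exact: measurable_rV_cons.
Qed.

HB.instance Definition _ := isMeasure.Build _ _ _ lebesgue_rV_step
  step0 step_ge0 step_sigma_additive.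

Lemma rV_cons_preimage (A : set R) (B : set 'rV[R]_n) :
  rV_cons @^-1` [set v | A (v ord0 ord0) /\
     B (\row_j v ord0 (lift ord0 j))] = A `*` B.
Proof.
apply/seteqP; split=> -[x v]/=; rewrite rV_cons0.
  by case=> Ax; rewrite (_ : \row_j _ = v)//; apply/rowP => j; rewrite mxE rV_consS.
case=> Ax Bv; split=> //; rewrite (_ : \row_j _ = v)//.
by apply/rowP => j; rewrite mxE rV_consS.
Qed.

Lemma measurable_rV_cylinder (A : set R) (B : set 'rV[R]_n) :
  measurable A -> measurable B ->
  measurable [set v : 'rV[R]_n.+1 | A (v ord0 ord0) /\
     B (\row_j v ord0 (lift ord0 j))].
Proof.
move=> mA mB; apply: measurableI.
  by rewrite -[X in measurable X]setTI; exact: (measurable_rV_coord ord0).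
rewrite -[X in measurable X]setTI.
have mt : measurable_fun [set: 'rV[R]_n.+1]
    (fun v => \row_j v ord0 (lift ord0 j) : 'rV[R]_n).
  apply: measurable_fun_rVP => j.
  rewrite (_ : _ \o _ = rV_coord (lift ord0 j)); last first.
    by apply/funext => v /=; rewrite /rV_coord mxE.
  exact: measurable_rV_coord.
exact: mt.
Qed.

Let step_sigma_finite : sigma_finite setT lebesgue_rV_step.
Proof.
have [F [TF ndF Foo]] := (sigma_finiteP _ _).1 (sigma_finiteT (@lebesgue_measure R)).
have [G [TG ndG Goo]] := (sigma_finiteP _ _).1 (sigma_finiteT m).
exists (fun k => [set v : 'rV[R]_n.+1 | F k (v ord0 ord0) /\
     G k (\row_j v ord0 (lift ord0 j))]).
  apply/esym/seteqP; split=> // v _.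
  have [i _ Fi] : (\bigcup_i F i) (v ord0 ord0) by rewrite -TF.
  have [j _ Gj] : (\bigcup_i G i) (\row_j v ord0 (lift ord0 j)) by rewrite -TG.
  exists (maxn i j) => //; split.
    by move: Fi; exact/subsetPset/ndF/leq_maxl.
  by move: Gj; exact/subsetPset/ndG/leq_maxr.
move=> k; have [mF ?] := Foo k; have [mG ?] := Goo k; split.
  exact: measurable_rV_cylinder.
rewrite /lebesgue_rV_step /pushforward rV_cons_preimage.
by rewrite product_measure1E// lte_mul_pinfty// ge0_fin_numE.
Qed.

HB.instance Definition _ := Measure_isSigmaFinite.Build _ _ _ lebesgue_rV_step
  step_sigma_finite.

End lebesgue_rV_step.

(* Lebesgue measure on R^n, by identifying R^(n+1) with R * R^n; on R^0 it is
   the unit mass at the only point. *)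
Fixpoint lebesgue_rV {R : realType} (n : nat) :
    {sigma_finite_measure set 'rV[R]_n -> \bar R} :=
  match n with
  | 0 => \d_(0 : 'rV[R]_0)
  | n'.+1 => lebesgue_rV_step (lebesgue_rV n')
  end.

Lemma lebesgue_rV_box {R : realType} (n : nat) (a b : 'rV[R]_n) :
  (forall i, a ord0 i <= b ord0 i) ->
  lebesgue_rV n [set v : 'rV[R]_n | forall i, a ord0 i <= v ord0 i <= b ord0 i] =
  (\prod_i (b ord0 i - a ord0 i))%:E.
Proof.
elim: n => [|n IH] in a b *; move=> ab.
  by rewrite big_ord0 /= diracE mem_set// => -[].
rewrite big_ord_recl EFinM.
pose tl (u : 'rV[R]_n.+1) : 'rV[R]_n := \row_j u ord0 (lift ord0 j).
pose B := [set v : 'rV[R]_n | forall i, tl a ord0 i <= v ord0 i <= tl b ord0 i].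
have mB : measurable B.
  rewrite (_ : B = \big[setI/setT]_(i < n) (rV_coord i @^-1` `[tl a ord0 i, tl b ord0 i])).
    apply: bigsetI_measurable => i _.
    rewrite -[X in measurable X]setTI; exact: measurable_rV_coord.
  rewrite -bigcap_seq; apply/seteqP; split => [v Bv i _|v Hv i].
    by rewrite /= in_itv/=; exact: Bv.
  by have := Hv i (mem_index_enum i); rewrite /= in_itv.
rewrite (_ : [set v | _] = [set v : 'rV[R]_n.+1 |
    `[a ord0 ord0, b ord0 ord0]%classic (v ord0 ord0) /\
    B (\row_j v ord0 (lift ord0 j))]).
  transitivity ((lebesgue_measure \x lebesgue_rV n)%E
      (`[a ord0 ord0, b ord0 ord0]%classic `*` B)).
    by rewrite -rV_cons_preimage.
  rewrite product_measure1E//=.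
  rewrite lebesgue_measure_itv/= lte_fin IH; last first.
    by move=> i; rewrite !mxE.
  congr (_ * _)%E; last by congr _%:E; apply: eq_bigr => i _; rewrite !mxE.
  case: ltP => //; have := ab ord0; rewrite le_eqVlt => /orP[/eqP->|/lt_geF->//].
  by rewrite subrr.
apply/seteqP; split=> v /=; rewrite in_itv/=.
  by move=> H; split=> // i; rewrite !mxE.
by case=> H0 H i; case: (unliftP ord0 i) => [j|] ->//; have := H j; rewrite !mxE.
Qed.

Section convex_geometry.
Context {R : realType} {n : nat}.
Implicit Types (K C : set 'rV[R]_n) (x y theta : 'rV[R]_n).

Definition dotv x y : R := \sum_i x ord0 i * y ord0 i.

Definition unit_sphere : set 'rV[R]_n := [set theta | dotv theta theta = 1].

Definition convex_body C :=
  [/\ @convex_set R 'rV[R]_n C, compact C & interior C !=set0].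

Definition zero_symmetric C := C = [set - x | x in C].

Definition dilate (c : R) C : set 'rV[R]_n := [set c *: x | x in C].

(* On compact non-empty sets, the supremum is a maximum. *)
Definition support_function C theta : R := sup [set dotv theta y | y in C].

Definition polar C : set 'rV[R]_n := [set y | forall x, C x -> dotv x y <= 1].

Definition is_centroid_body (p : R) K C :=
  convex_body C /\
  forall theta, support_function C theta =
    (\int[lebesgue_rV n]_(x in K) (`|dotv x theta| `^ p)) `^ p^-1.

(* A convex body is determined by its support function, so [is_centroid_body]
   has at most one solution; the default value [set0] is used when it has
   none. *)
Definition centroid_body (p : R) K : set 'rV[R]_n :=
  xget set0 [set C | is_centroid_body p K C].

Definition slab_width (delta : R) K theta : R :=
  sup [set t | 0 < t /\
    lebesgue_rV n [set x | K x /\ `|dotv x theta| <= t] = (1 - delta)%:E].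

Definition floating_body (delta : R) K : set 'rV[R]_n :=
  \bigcap_(theta in unit_sphere)
    [set x | K x /\ `|dotv x theta| <= slab_width delta K theta].

End convex_geometry.

(* Main.v *)
Require Import Defs.
From HB Require Import structures.
From mathcomp Require Import all_boot all_order all_algebra.
From mathcomp Require Import all_classical all_reals all_analysis.
From mathcomp Require Import measurable_realfun ring lra.

(** Write p = ln (1 / delta) >= 1, so that delta = e^-p, fix a unit vector theta,
    let S x = |<x, theta>|, and let h theta be the L_p norm of S on K.  Below, P and
    E refer to a uniformly distributed point of K.  Let t be a level with
    P(S <= t) = 1 - delta; such a t exists because hyperplanes are null sets
    ([slab_attains]).  Everything reduces to comparing t with
    h theta, up to constants that do not depend on n.

    Markov's inequality gives t^p * delta <= h theta ^ p, that is
    t <= e * h theta ([markov_width]).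

    The converse h theta <= 150 * t is where convexity enters.  The midpoint of a
    point of K with S > 2s + t and a point of K with S <= t is a point of K with
    S > s.  The multiplicative Brunn-Minkowski inequality, which is free of the
    dimension, then gives P(S > 2s + t) (1 - delta) <= P(S > s)^2
    ([tail_doubling]), hence P(S > 7t) <= delta^4 / (1 - delta)^3.  Its functional
    form, the Prekopa-Leindler inequality, applied once more with the weight S^p
    instead of 1 ([tail_moment]), gives
      E[S^p; S > 15t] (1 - delta) <= (15/7)^p E[S^p] P(S > 7t).
    For delta = e^-p the right-hand side is at most 9/10 (1 - delta) E[S^p]
    ([tail_constant]), so this tail can be absorbed:
    E[S^p] <= 10 (15 t)^p <= (150 t)^p ([moment_le]).

    The Prekopa-Leindler inequality ([prekopa_leindler]) is proved by induction on
    the dimension; Lebesgue measure on R^n is an iterated product, so the inductive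
    step integrates out one coordinate.  On the line it follows, through the layer
    cake formula, from the Brunn-Minkowski inequality for superlevel sets.

    The comparison of t with h theta bounds the slab widths that define the
    floating body.  Inclusions follow since a compact convex set is determined by
    its support function ([in_convex_body]), and the polar inclusions are formal.
    The L_p centroid body is the intersection C of the half-spaces
    {y | <theta, y> <= h theta}.  That its support function equals h, and not less,
    is shown by an explicit contact point in each direction, the gradient of h,
    which belongs to C by Holder's inequality ([contact_point]). *)

Set Implicit Arguments.
Unset Strict Implicit.
Unset Printing Implicit Defensive.

Import Order.TTheory GRing.Theory Num.Theory.
Import numFieldNormedType.Exports.

Local Open Scope classical_set_scope.
Local Open Scope ring_scope.

(** * Lebesgue measure on R^n *)

Section measure_rV.
Context {R : realType}.

Lemma measurable_coordwise (n : nat) (F : 'I_n -> set R) :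
  (forall i, measurable (F i)) ->
  measurable [set v : 'rV[R]_n | forall i, F i (v ord0 i)].
Proof.
move=> mF.
rewrite (_ : mkset _ = \big[setI/setT]_(i < n) (rV_coord i @^-1` F i)).
  apply: bigsetI_measurable => i _.
  by rewrite -[X in measurable X]setTI; exact: measurable_rV_coord.
rewrite -bigcap_seq; apply/seteqP; split => [v Fv i _|v Fv i]; first exact: Fv.
exact: (Fv i (mem_index_enum i)).
Qed.

(** The sigma-algebra is generated by the coordinates, the topology by the sup
    norm; they agree because an open set is the union of the countably many
    rational boxes that it contains. *)
Lemma open_measurable_rV (n : nat) (U : set 'rV[R]_n) : open U -> measurable U.
Proof.
move=> oU.
pose box (q : 'rV[rat]_n * nat) : set 'rV[R]_n :=
  [set v | forall i, ball (ratr (q.1 ord0 i) : R) q.2.+1%:R^-1 (v ord0 i)].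
pose F q := [set v | box q v /\ box q `<=` U].
have mbox q : measurable (box q).
  apply: (@measurable_coordwise n (fun i => ball (ratr (q.1 ord0 i) : R) q.2.+1%:R^-1)).
  by move=> i; exact: measurable_realfun.measurable_ball.
have -> : U = \bigcup_q F q.
  apply/seteqP; split=> [x Ux|x [q _ [bx bU]]]; last exact: bU.
  have /nbhs_ballP[e /= e0 eU] : nbhs x U by exact: open_nbhs_nbhs.
  have [k ke] : exists k : nat, 0 + k.+1%:R^-1 < e / 2.
    by apply: ltr_add_invr; rewrite divr_gt0.
  rewrite add0r in ke.
  have k0 : 0 < k.+1%:R^-1 :> R by rewrite invr_gt0.
  have /choice[q qx] : forall i, exists q : rat,
      ratr q \in `]x ord0 i - k.+1%:R^-1, x ord0 i + k.+1%:R^-1[.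
    by move=> i; apply: rat_in_itvoo; rewrite ltrBlDr -addrA ltrDl addr_gt0.
  exists (\row_i q i, k) => //; split.
    by move=> i /=; rewrite mxE /ball/= ltr_distl; have := qx i; rewrite in_itv.
  move=> v vq; apply: eU; rewrite mx_norm_ball /ball_/= [`|_|]mx_normrE.
  apply/bigmax_ltP; split=> // -[i j] _ /=; rewrite ord1 !mxE.
  move: ke (qx j) (vq j); rewrite /= mxE /ball/= ltr_distl in_itv/=.
  move: (_^-1) => r re /andP[? ?] /andP[? ?]; rewrite ltr_norml; lra.
apply: countable_bigcupT_measurable => //.
move=> q; have [bU|nbU] := pselect (box q `<=` U).
  by rewrite (_ : F q = box q)//; apply/seteqP; split=> [v []|v].
by rewrite (_ : F q = set0)//; apply/seteqP; split=> // v [].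
Qed.

Lemma closed_measurable_rV (n : nat) (C : set 'rV[R]_n) : closed C -> measurable C.
Proof.
by move=> cC; rewrite -[C]setCK; apply: measurableC; apply: open_measurable_rV; exact: closed_openC.
Qed.

Lemma measurable_dotv (n : nat) (theta : 'rV[R]_n) :
  measurable_fun [set: 'rV[R]_n] (dotv ^~ theta).
Proof.
rewrite /dotv; elim: (index_enum _) => [|i s IH].
  by under eq_fun do rewrite big_nil; exact: measurable_cst.
under eq_fun do rewrite big_cons.
by apply: measurable_funD => //; apply: measurable_funM => //; exact: measurable_rV_coord.
Qed.

Lemma ge0_integral_rVS (n : nat) (f : 'rV[R]_n.+1 -> \bar R) :
  measurable_fun setT f -> (forall x, 0 <= f x)%E ->
  (\int[lebesgue_rV n.+1]_x f x =
   \int[lebesgue_measure]_s \int[lebesgue_rV n]_y f (rV_cons (s, y)))%E.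
Proof.
move=> mf f0.
transitivity (\int[pushforward (lebesgue_measure \x lebesgue_rV n) (@rV_cons R n)]_x f x)%E => //.
rewrite (@ge0_integral_pushforward _ _ _ _ _ _ (@measurable_rV_cons R n)
  (lebesgue_measure \x lebesgue_rV n)%E)//.
rewrite preimage_setT fubini_tonelli1//.
  by apply: measurableT_comp => //; exact: measurable_rV_cons.
by move=> z; exact: f0.
Qed.

Lemma dotv_rV_cons (n : nat) (s : R) (y : 'rV[R]_n) (theta : 'rV[R]_n.+1) :
  dotv (rV_cons (s, y)) theta =
  s * theta ord0 ord0 + dotv y (\row_j theta ord0 (lift ord0 j)).
Proof.
rewrite /dotv big_ord_recl rV_cons0; congr (_ + _).
by apply: eq_bigr => j _; rewrite rV_consS mxE.
Qed.

(** By Fubini and induction on the dimension: if some coordinate of theta other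
    than the first is nonzero, the slices over the first coordinate are
    hyperplanes, otherwise the first coordinate is constant on the set. *)
Lemma hyperplane_null (n : nat) (theta : 'rV[R]_n) (c : R) : theta != 0 ->
  lebesgue_rV n [set x | dotv x theta = c] = 0%E.
Proof.
have mH k (eta : 'rV[R]_k) b : measurable [set x | dotv x eta = b].
  have := @measurable_dotv _ eta measurableT [set b] (measurable_set1 b).
  by rewrite setTI.
elim: n theta c => [|n IH] theta c theta0.
  by move: theta0; rewrite (_ : theta = 0) ?eqxx//; apply/rowP => -[].
rewrite -[X in lebesgue_rV _ X]setIT -integral_indic; [|exact: measurableT|exact: mH].
rewrite ge0_integral_rVS; last 2 first.
- by apply/measurable_EFinP; apply: measurable_indic; exact: mH.
- by move=> x; rewrite lee_fin.
pose tl : 'rV[R]_n := \row_j theta ord0 (lift ord0 j).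
have [tl0|tl0] := eqVneq tl 0; last first.
  apply: integral0_eq => s _.
  rewrite (_ : (fun y => _) = (fun y => (\1_[set y | dotv y tl = c - s * theta ord0 ord0] y)%:E)).
    by rewrite integral_indic ?setIT; [exact: IH|exact: measurableT|exact: mH].
  apply/funext => y; rewrite !indicE; congr ((nat_of_bool _)%:R%:E).
  apply/idP/idP; rewrite !inE/= dotv_rV_cons -/tl => H.
    by rewrite -H addrC addKr.
  by rewrite H addrC subrK.
have th0 : theta ord0 ord0 != 0.
  apply: contra_neq theta0 => th0; apply/rowP => i; rewrite mxE.
  case: (unliftP ord0 i) => [j|] ->//.
  by have /rowP/(_ j) := tl0; rewrite !mxE.
rewrite (_ : (fun s => _) = (fun s => (\1_[set c / theta ord0 ord0] s)%:E * lebesgue_rV n setT)%E).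
  rewrite ge0_integralZr//; last by apply/measurable_EFinP; exact: measurable_indic.
  rewrite integral_indic// setIT [X in (X * _)%E](_ : _ = 0%E) ?mul0e//.
  exact: lebesgue_measure_set1.
apply/funext => s; under eq_integral.
  move=> y _.
  rewrite (_ : \1_ _ _ = \1_[set c / theta ord0 ord0] s); first over.
  rewrite !indicE; congr ((nat_of_bool _)%:R); apply/idP/idP; rewrite !inE/= dotv_rV_cons -/tl tl0;
    rewrite (_ : dotv y 0 = 0) ?addr0; try by rewrite /dotv big1// => i _; rewrite mxE mulr0.
    by move=> <-; rewrite mulfK.
  by move=> ->; rewrite divfK.
by rewrite integral_cst.
Qed.

End measure_rV.

(** * Brunn-Minkowski on the line *)

Section brunn_minkowski_line.
Context {R : realType}.
Local Notation mu := (@lebesgue_measure R).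
Implicit Types (A B C : set R) (f g h : R -> R).

Lemma measurable_midpoint (b : R) :
  measurable_fun setT (fun x : measurableTypeR R => 2^-1 * (x + b) : measurableTypeR R).
Proof.
by apply: measurable_funM => //; apply: measurable_funD.
Qed.

Lemma lebesgue_measure_midpoint (b : R) A : measurable A ->
  mu ((fun x => 2^-1 * (x + b)) @^-1` A) = (2%:E * mu A)%E.
Proof.
move=> mA.
have h2 : 0 <= 2^-1 :> R by rewrite invr_ge0.
pose phi := (fun x : measurableTypeR R => 2^-1 * (x + b) : measurableTypeR R).
have mphi : measurable_fun setT phi := measurable_midpoint b.
pose m : {measure set (measurableTypeR R) -> \bar R} := mscale (NngNum h2)
  (measure_function_pushforward__canonical__measure_function_Measure mu mphi).
suff -> : mu A = m A.
  by rewrite /m /= /mscale /= muleA -EFinM divff// mul1e.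
apply: lebesgue_measure_unique => // _ [[x y] _ <-].
rewrite /m /= /mscale /pushforward /=.
rewrite [pushforward _ _ _](_ : _ = mu `]2 * x - b, 2 * y - b]%classic); last first.
  congr (mu _).
  by apply/seteqP; split=> z; rewrite /= /phi !in_itv/= => /andP[? ?]; apply/andP; split; lra.
rewrite !lebesgue_measure_itv/= !lte_fin.
rewrite ltrD2r ltr_pM2l//; case: ifP => _; last by rewrite mule0.
by rewrite -!EFinB -EFinM; congr (_%:E); lra.
Qed.

(** If a were the largest point of A and b the smallest point of B, the midpoints
    of A with b and of a with B would be half-size copies of A and B, inside C and
    on either side of m = (a + b) / 2.  Points of A and B that are e / 2 close to
    the supremum and the infimum lose at most e. *)
Lemma brunn_minkowski_line (r : R) A B C :
  measurable A -> measurable B -> measurable C ->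
  A `<=` `[-r, r] -> B `<=` `[-r, r] -> A !=set0 -> B !=set0 ->
  (forall a b, A a -> B b -> C (2^-1 * (a + b))) ->
  (mu A + mu B <= 2%:E * mu C)%E.
Proof.
move=> mA mB mC Ar Br A0 B0 ABC.
have supA : has_sup A.
  by split=> //; exists r => x /Ar; rewrite /= in_itv/= => /andP[].
have infB : has_inf B.
  by split=> //; exists (-r) => x /Br; rewrite /= in_itv/= => /andP[].
apply/lee_addgt0Pr => e e0.
have e20 : 0 < e / 2 by rewrite divr_gt0.
have [a Aa asup] := sup_adherent e20 supA.
have [b Bb binf] := inf_adherent e20 infB.
pose m := 2^-1 * (a + b).
have le1 : (mu A <= 2%:E * mu (C `&` `]-oo, m]) + (e / 2)%:E)%E.
  have -> : (e / 2)%:E = mu `]a, a + e / 2].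
    by rewrite lebesgue_measure_itv/= lte_fin ltrDl e20 -EFinB addrAC subrr add0r.
  rewrite -(lebesgue_measure_midpoint b); last exact: measurableI.
  have mD : measurable ((fun x : R => 2^-1 * (x + b)) @^-1` (C `&` `]-oo, m])).
    rewrite -[X in measurable X]setTI; apply: measurable_midpoint => //.
    exact: measurableI.
  apply: le_trans (measureU2 mu mD (measurable_itv _)).
  apply: le_measure; rewrite ?inE//; first exact: measurableU.
  move=> x Ax; have [xa|ax] := leP x a; [left|right] => /=.
    split; first exact: ABC.
    by rewrite in_itv/= /m; lra.
  rewrite in_itv/= ax/=.
  have := sup_upper_bound supA Ax; move: asup; move: (sup A) => s; lra.
have le2 : (mu B <= 2%:E * mu (C `&` `]m, +oo[) + (e / 2)%:E)%E.
  have -> : (e / 2)%:E = mu `]b - e / 2, b].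
    rewrite lebesgue_measure_itv/= lte_fin gtrDl oppr_lt0 e20 -EFinB; congr (_%:E).
    by rewrite opprB addrC subrK.
  rewrite -(lebesgue_measure_midpoint a); last exact: measurableI.
  have mD : measurable ((fun x : R => 2^-1 * (x + a)) @^-1` (C `&` `]m, +oo[)).
    rewrite -[X in measurable X]setTI; apply: measurable_midpoint => //.
    exact: measurableI.
  apply: le_trans (measureU2 mu mD (measurable_itv _)).
  apply: le_measure; rewrite ?inE//; first exact: measurableU.
  move=> x Bx; have [bx|xb] := ltP b x; [left|right] => /=.
    split; first by rewrite addrC; exact: ABC.
    by rewrite in_itv/= /m andbT; lra.
  rewrite in_itv/= xb andbT.
  have := ge_inf (proj2 infB) Bx; move: binf; move: (inf B) => s; lra.
have -> : mu C = (mu (C `&` `]-oo, m]) + mu (C `&` `]m, +oo[))%E.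
  rewrite -measureU; [|exact: measurableI|exact: measurableI|].
    rewrite -setIUr (_ : _ `|` _ = setT) ?setIT//; apply/seteqP; split=> // x _.
    by rewrite /= !in_itv/= andbT; case: leP; [left|right].
  apply/seteqP; split => // x [[_ +] [_ +]].
  by rewrite /= !in_itv/= andbT => ?; rewrite ltNge => /negP.
rewrite ge0_muleDr//; apply: (le_trans (leeD le1 le2)).
rewrite addeACA leeD// -EFinD lee_fin; lra.
Qed.

Lemma layer_cake f : measurable_fun setT f -> (forall x, 0 <= f x) ->
  (\int[mu]_x (f x)%:E = \int[mu]_(t in `[0%R, +oo[) mu [set x | (t < f x)%R])%E.
Proof.
move=> mf f0.
transitivity (\int[mu]_x \int[mu]_t (\1_`[0, f x[ t)%:E)%E.
  apply: eq_integral => x _; rewrite integral_indic// setIT.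
  apply: (etrans _ (esym (lebesgue_measure_itv _))) => /=.
  rewrite lte_fin sube0; case: ltP => // fx0.
  by congr (_%:E); apply/eqP; rewrite eq_le fx0 f0.
have mS : measurable [set p : measurableTypeR R * measurableTypeR R | `[0, f p.1[%classic p.2].
  rewrite [X in measurable X](_ : _ =
      (fun p : measurableTypeR R * measurableTypeR R => 0 <= p.2) @^-1` [set true] `&`
      (fun p : measurableTypeR R * measurableTypeR R => p.2 < f p.1) @^-1` [set true]).
    apply: measurableI; rewrite -[X in measurable X]setTI.
      have H : measurable_fun setT (fun p : measurableTypeR R * measurableTypeR R => 0 <= p.2).
        exact: measurable_fun_ler.
      exact: H.
    have H : measurable_fun setT (fun p : measurableTypeR R * measurableTypeR R => p.2 < f p.1).
      by apply: measurable_fun_ltr => //; exact: measurableT_comp.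
    exact: H.
  by apply/seteqP; split => p; rewrite /= in_itv/= => /andP.
rewrite (fubini_tonelli (fun p : measurableTypeR R * measurableTypeR R =>
  (\1_`[0, f p.1[ p.2)%:E)).
- rewrite [in RHS]integral_mkcond; apply: eq_integral => t _; rewrite patchE.
  have mlt : measurable [set x | t < f x].
    rewrite -[X in measurable X]setTI.
    have : measurable_fun setT (fun x => t < f x) by exact: measurable_fun_ltr.
    by move=> /(_ measurableT [set true]); rewrite setTI; exact.
  have [t0|t0] := leP 0 t.
    rewrite mem_set/= ?in_itv/= ?t0//.
    rewrite -[X in mu X]setIT -integral_indic//; apply: eq_integral => x _.
    by rewrite !indicE; congr ((nat_of_bool _)%:R%:E); apply/idP/idP; rewrite !inE/= in_itv/= t0.
  rewrite memNset/= ?in_itv/= ?leNgt ?t0//.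
  apply: integral0_eq => x _; rewrite indicE memNset//= in_itv/=.
  by rewrite leNgt t0.
- apply/measurable_EFinP.
  rewrite (_ : (fun p => _) = \1_[set p : measurableTypeR R * measurableTypeR R |
    `[0, f p.1[%classic p.2]); first exact: measurable_indic.
  by apply/funext => p; rewrite !indicE; congr ((nat_of_bool _)%:R); apply/idP/idP; rewrite !inE.
- by move=> p; rewrite lee_fin.
Qed.

End brunn_minkowski_line.

(** * The Prekopa-Leindler inequality *)

Section prekopa_leindler_line.
Context {R : realType}.
Local Notation mu := (@lebesgue_measure R).

Lemma measurable_superlevel d (T : measurableType d) (f : T -> R) (t : R) :
  measurable_fun setT f -> measurable [set x | t < f x].
Proof.
move=> mf; have : measurable_fun setT (fun x => t < f x) by exact: measurable_fun_ltr.
by move=> /(_ measurableT [set true]); rewrite setTI; exact.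
Qed.

Lemma measurable_distribution (f : R -> R) : measurable_fun setT f ->
  measurable_fun setT (fun t : R => mu [set x | t < f x]).
Proof.
move=> mf.
have mS : measurable [set p : measurableTypeR R * measurableTypeR R | p.2 < f p.1].
  have H : measurable_fun setT (fun p : measurableTypeR R * measurableTypeR R => p.2 < f p.1).
    by apply: measurable_fun_ltr => //; exact: measurableT_comp.
  by have := H measurableT [set true]; rewrite setTI; exact.
have := measurable_fun_ysection mu mS.
apply: eq_measurable_fun => t _ /=; congr (mu _).
by apply/seteqP; split=> x; rewrite /ysection/= inE.
Qed.

Definition segment (r : R) : set R := [set x | `|x| <= r].

Definition cube n (r : R) : set 'rV[R]_n := [set v | forall i, `|v ord0 i| <= r].

(** This class is stable under slicing and under integrating out a coordinate, and
    its integrals are finite, so that the induction on the dimension can be carried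
    out with real numbers. *)
Definition bump_fun d (T : measurableType d) (box : R -> set T) (f : T -> R) :=
  [/\ measurable_fun setT f, exists M, forall x, 0 <= f x <= M &
    exists2 r, 0 <= r & forall x, ~ box r x -> f x = 0].

Lemma bounded_integrable d (T : measurableType d) (m : {measure set T -> \bar R})
    (D : set T) (f : T -> R) (M : R) :
  measurable D -> (m D < +oo)%E -> measurable_fun setT f ->
  (forall x, D x -> `|f x| <= M) -> m.-integrable D (EFin \o f).
Proof.
move=> mD Dfin mf fM; apply: measurable_bounded_integrable => //.
  exact: measurable_funTS.
exists M; split; first exact: num_real.
move=> N MN x Dx; apply: (le_trans (fM _ Dx)); exact: ltW.
Qed.

Lemma Rintegral1 d (T : measurableType d) (m : {measure set T -> \bar R}) (D : set T) :
  measurable D -> \int[m]_(x in D) cst 1 x = fine (m D).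
Proof. by move=> mD; rewrite Rintegral_cst// mul1r. Qed.

Lemma patch_support d (T : measurableType d) (D : set T) (f : T -> R) :
  (forall x, ~ D x -> f x = 0) -> f \_ D = f.
Proof.
move=> f0; apply/funext => x; rewrite patchE; case: ifPn => // /negP nD.
by rewrite f0// => Dx; apply: nD; rewrite inE.
Qed.

Lemma segmentE r : segment r = `[-r, r]%classic.
Proof. by apply/seteqP; split=> x; rewrite /segment/= in_itv/= ler_norml. Qed.

Lemma measurable_segment r : measurable (segment r).
Proof. by rewrite segmentE; exact: measurable_itv. Qed.

Lemma segment_finite r : (mu (segment r) < +oo)%E.
Proof. by rewrite segmentE lebesgue_measure_itv/=; case: ifP => // _; rewrite -EFinB ltry. Qed.

Lemma measurable_cube n r : measurable (cube r : set 'rV[R]_n).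
Proof.
by apply: (@measurable_coordwise R n (fun=> segment r)) => i; exact: measurable_segment.
Qed.

Lemma cube_finite n r : 0 <= r -> (lebesgue_rV n (cube r) < +oo)%E.
Proof.
move=> r0.
pose a : 'rV[R]_n := \row__ (- r); pose b : 'rV[R]_n := \row__ r.
rewrite (_ : cube r = [set v | forall i, a ord0 i <= v ord0 i <= b ord0 i]).
  by rewrite lebesgue_rV_box ?ltry// => i; rewrite !mxE; lra.
by apply/seteqP; split=> v vr i; move: (vr i); rewrite !mxE ler_norml.
Qed.

Lemma bump_integrable d (T : measurableType d) (m : {measure set T -> \bar R})
    (box : R -> set T) (f : T -> R) :
  (forall r, measurable (box r)) -> (forall r, 0 <= r -> (m (box r) < +oo)%E) ->
  bump_fun box f -> m.-integrable setT (EFin \o f).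
Proof.
move=> mbox boxfin [mf [M fM] [r r0 fr]].
rewrite -(patch_support fr) -restrict_EFin.
apply/(integrable_mkcond (EFin \o f) (mbox r)).
apply: (bounded_integrable (M := M)) => //; first exact: boxfin.
by move=> x _; have /andP[? ?] := fM x; rewrite ger0_norm.
Qed.

Lemma bump_line_integrable (f : R -> R) : bump_fun segment f -> mu.-integrable setT (EFin \o f).
Proof.
by apply: (@bump_integrable _ _ mu segment f) => [r|r _];
  [exact: measurable_segment|exact: segment_finite].
Qed.

Lemma bump_rV_integrable n (f : 'rV[R]_n -> R) : bump_fun (@cube n) f ->
  (lebesgue_rV n).-integrable setT (EFin \o f).
Proof.
by apply: (@bump_integrable _ _ (lebesgue_rV n) (@cube n) f) => r;
  [exact: measurable_cube|exact: cube_finite].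
Qed.

(** Dividing by their suprema makes the superlevel sets of f and g empty or
    nonempty at the same time, and Brunn-Minkowski needs nonempty sets.  With this
    normalization it can be applied at every level t < 1, and integrating over t
    gives an additive inequality, stronger than the multiplicative one by the
    inequality between the arithmetic and geometric means. *)
Lemma prekopa_leindler_sup (r : R) (f g h : R -> R) (a b c : R) :
  0 < a -> 0 < b -> 0 < c ->
  measurable_fun setT f -> measurable_fun setT g -> measurable_fun setT h ->
  (forall x, 0 <= f x <= a) -> (forall x, 0 <= g x <= b) -> (forall x, 0 <= h x) ->
  (forall x, ~ segment r x -> f x = 0) -> (forall x, ~ segment r x -> g x = 0) ->
  (forall t, t < 1 -> exists x, t < f x / a) ->
  (forall t, t < 1 -> exists x, t < g x / b) ->
  (forall x y t, 0 <= t -> t < f x / a -> t < g y / b -> t < h (2^-1 * (x + y)) / c) ->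
  (\int[mu]_x (f x / a)%:E + \int[mu]_x (g x / b)%:E <= 2%:E * \int[mu]_x (h x / c)%:E)%E.
Proof.
move=> a0 b0 c0 mf mg mh fa gb h0 fr gr supf supg fgh.
have mfa : measurable_fun setT (fun x => f x / a) by exact: measurable_funM.
have mgb : measurable_fun setT (fun x => g x / b) by exact: measurable_funM.
have mhc : measurable_fun setT (fun x => h x / c) by exact: measurable_funM.
rewrite !layer_cake//; last 3 first.
- by move=> x; rewrite divr_ge0// ltW.
- by move=> x; rewrite divr_ge0 ?(ltW b0)//; have /andP[] := gb x.
- by move=> x; rewrite divr_ge0 ?(ltW a0)//; have /andP[] := fa x.
have mdist (k : R -> R) : measurable_fun setT k ->
    measurable_fun (`[0, +oo[%classic : set R) (fun t : R => mu [set x | t < k x]).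
  by move=> mk; apply: measurable_funTS; exact: measurable_distribution.
rewrite -ge0_integralD//; [|exact: mdist|exact: mdist].
rewrite -ge0_integralZl//; last exact: mdist.
apply: ge0_le_integral => //.
- by move=> t _; rewrite adde_ge0.
- by apply: emeasurable_funD; exact: mdist.
- by apply: measurable_funeM; exact: mdist.
move=> t /=; rewrite in_itv/= andbT => t0.
(* both sets on the left-hand side are empty as soon as t >= 1 *)
have [t1|t1] := ltP t 1; last first.
  rewrite (_ : [set x | _] = set0) ?measure0 ?add0e; last first.
    apply/seteqP; split => // x /=; apply/negP; rewrite -leNgt (le_trans _ t1)//.
    by rewrite ler_pdivrMr// mul1r; have /andP[] := fa x.
  rewrite (_ : [set x | _] = set0) ?measure0 ?mule_ge0//.
  apply/seteqP; split => // x /=; apply/negP; rewrite -leNgt (le_trans _ t1)//.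
  by rewrite ler_pdivrMr// mul1r; have /andP[] := gb x.
apply: (@brunn_minkowski_line _ r); try exact: measurable_superlevel.
- rewrite -segmentE => x /= tx; apply: contrapT => /fr fx0.
  by move: tx; rewrite fx0 mul0r ltNge t0.
- rewrite -segmentE => x /= tx; apply: contrapT => /gr fx0.
  by move: tx; rewrite fx0 mul0r ltNge t0.
- by have [x] := supf _ t1; exists x.
- by have [x] := supg _ t1; exists x.
- by move=> x y; exact: fgh.
Qed.

Lemma sup_range_normalization (f : R -> R) M x0 : (forall x, 0 <= f x <= M) -> 0 < f x0 ->
  [/\ 0 < sup (range f), forall x, 0 <= f x <= sup (range f) &
     forall t, t < 1 -> exists x, t < f x / sup (range f)].
Proof.
move=> fM fx0.
have hs : has_sup (range f).
  by split; [exists (f x0), x0|exists M => _ [x _ <-]; have /andP[] := fM x].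
have s0 : 0 < sup (range f).
  by apply: (lt_le_trans fx0); apply: (sup_upper_bound hs); exists x0.
split=> //.
  move=> x; have /andP[-> _]/= := fM x.
  by apply: (sup_upper_bound hs); exists x.
move=> t t1; have e0 : 0 < (1 - t) * sup (range f) by rewrite mulr_gt0// subr_gt0.
have [_ [x _ <-] xs] := sup_adherent e0 hs; exists x.
by rewrite ltr_pdivlMr//; move: xs; rewrite mulrBl mul1r subKr.
Qed.

Lemma prekopa_leindler_line (f g h : R -> R) :
  bump_fun segment f -> bump_fun segment g -> bump_fun segment h ->
  (forall x y, f x * g y <= h (2^-1 * (x + y)) ^+ 2) ->
  (\int[mu]_x f x) * (\int[mu]_x g x) <= (\int[mu]_x h x) ^+ 2.
Proof.
move=> bf bg bh fgh.
have intf := bump_line_integrable bf.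
have intg := bump_line_integrable bg.
have inth := bump_line_integrable bh.
have [[x0 fx0]|f0] := pselect (exists x, f x != 0); last first.
  rewrite [X in X * _](_ : _ = 0) ?mul0r ?sqr_ge0// -[RHS](Rintegral_set0 mu f).
  rewrite [RHS]Rintegral_mkcond; apply: eq_Rintegral => x _.
  by rewrite patch_set0; apply: contrapT => fx; apply: f0; exists x; apply/eqP.
have [[y0 gy0]|g0] := pselect (exists x, g x != 0); last first.
  rewrite [X in _ * X](_ : _ = 0) ?mulr0 ?sqr_ge0// -[RHS](Rintegral_set0 mu g).
  rewrite [RHS]Rintegral_mkcond; apply: eq_Rintegral => x _.
  by rewrite patch_set0; apply: contrapT => fx; apply: g0; exists x; apply/eqP.
have [mf [M fM] [r r0 fr]] := bf.
have [mg [N gN] [s s0 gs]] := bg.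
have [mh [L hL] _] := bh.
have [] := @sup_range_normalization f M x0 fM.
  by rewrite lt_neqAle eq_sym fx0; have /andP[] := fM x0.
have [] := @sup_range_normalization g N y0 gN.
  by rewrite lt_neqAle eq_sym gy0; have /andP[] := gN y0.
move: (sup _) (sup _) => a b b0 gb supg a0 fa supf.
(* the scale of h for which f > a t and g > b t force h > c t *)
pose c := Num.sqrt (a * b).
have c0 : 0 < c by rewrite sqrtr_gt0 mulr_gt0.
have c2 : c ^+ 2 = a * b by rewrite sqr_sqrtr// ltW// mulr_gt0.
have h0 x : 0 <= h x by have /andP[] := hL x.
have := @prekopa_leindler_sup (Num.max r s) f g h a b c a0 b0 c0 mf mg mh fa gb h0.
have sub x : ~ segment (Num.max r s) x -> ~ segment r x /\ ~ segment s x.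
  by rewrite /segment/= le_max => /negP; rewrite negb_or => /andP[/negP ? /negP ?].
move=> /(_ (fun x Hx => fr x (sub x Hx).1) (fun x Hx => gs x (sub x Hx).2) supf supg).
have key x y t : 0 <= t -> t < f x / a -> t < g y / b -> t < h (2^-1 * (x + y)) / c.
  move=> t0; rewrite !ltr_pdivlMr// => tf tg.
  rewrite -(@ltr_pXn2r _ 2) ?nnegrE ?mulr_ge0 ?(ltW c0)//.
  apply: lt_le_trans (fgh x y); rewrite exprMn c2 expr2 mulrACA.
  by apply: ltr_pM => //; rewrite mulr_ge0// ltW.
move=> /(_ key) {key}.
have int1 (k : R -> R) (e : R) : mu.-integrable setT (EFin \o k) ->
    (\int[mu]_x (k x / e)%:E = ((\int[mu]_x k x) / e)%:E)%E.
  move=> ik; rewrite -RintegralZr// fineK//; apply: integrable_fin_num => //.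
  have : mu.-integrable setT (fun x => (EFin \o k) x * (e^-1)%:E)%E by exact: integrableZr.
  by apply: eq_integrable.
rewrite !int1// -EFinD -EFinM lee_fin.
have If : 0 <= \int[mu]_x f x by apply: Rintegral_ge0 => x _; have /andP[] := fM x.
have Ig : 0 <= \int[mu]_x g x by apply: Rintegral_ge0 => x _; have /andP[] := gN x.
have Ih : 0 <= \int[mu]_x h x by apply: Rintegral_ge0 => x _.
move: (\int[mu]_x f x) (\int[mu]_x g x) (\int[mu]_x h x) If Ig Ih => F G H F0 G0 H0 FGH.
have Fa0 : 0 <= F / a by rewrite divr_ge0// ltW.
have Gb0 : 0 <= G / b by rewrite divr_ge0// ltW.
have Hc0 : 0 <= H / c by rewrite divr_ge0// ltW.
have : (F / a) * (G / b) <= (H / c) ^+ 2.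
  move: (F / a) (G / b) (H / c) Fa0 Gb0 Hc0 FGH => u v w u0 v0 w0 uvw.
  have := sqr_ge0 (u - v); have : (u + v) ^+ 2 <= (2 * w) ^+ 2.
    by rewrite ler_pXn2r// nnegrE; lra.
  nra.
rewrite exprMn exprVn c2 mulrACA -invfM ler_pM2r//.
by rewrite invr_gt0 mulr_gt0.
Qed.

End prekopa_leindler_line.

Section prekopa_leindler.
Context {R : realType}.
Local Notation mu := (@lebesgue_measure R).

Definition marginal n (f : 'rV[R]_n.+1 -> R) (s : R) : R :=
  \int[lebesgue_rV n]_y f (rV_cons (s, y)).

Lemma cube_rV_cons n r (s : R) (y : 'rV[R]_n) :
  cube r (rV_cons (s, y)) <-> segment r s /\ cube r y.
Proof.
split=> [H|[sr yr] i].
  split=> [|i]; first by have := H ord0; rewrite rV_cons0.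
  by have := H (lift ord0 i); rewrite rV_consS.
by case: (unliftP ord0 i) => [j|] ->; rewrite ?rV_consS ?rV_cons0//; exact: yr.
Qed.

Lemma measurable_slice n (f : 'rV[R]_n.+1 -> R) (s : R) :
  measurable_fun setT f -> measurable_fun setT (fun y : 'rV[R]_n => f (rV_cons (s, y))).
Proof.
move=> mf; apply: measurableT_comp => //.
apply: (@measurableT_comp _ _ _ _ _ _ (@rV_cons R n)); first exact: measurable_rV_cons.
exact: measurable_pair1.
Qed.

Lemma bump_slice n (f : 'rV[R]_n.+1 -> R) (s : R) :
  bump_fun (@cube R n.+1) f -> bump_fun (@cube R n) (fun y => f (rV_cons (s, y))).
Proof.
move=> [mf [M fM] [r r0 fr]]; split; first exact: measurable_slice.
  by exists M.
by exists r => // y ry; apply: fr => /cube_rV_cons[].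
Qed.

Lemma integral_slice n (f : 'rV[R]_n.+1 -> R) (s : R) : bump_fun (@cube R n.+1) f ->
  (\int[lebesgue_rV n]_y (f (rV_cons (s, y)))%:E)%E = (marginal f s)%:E.
Proof.
move=> bf; rewrite /marginal fineK//; apply: integrable_fin_num => //.
exact: bump_rV_integrable (bump_slice s bf).
Qed.

Lemma bump_marginal n (f : 'rV[R]_n.+1 -> R) :
  bump_fun (@cube R n.+1) f -> bump_fun segment (marginal f).
Proof.
move=> bf; have [mf [M fM] [r r0 fr]] := bf; split.
- apply/measurable_EFinP.
  rewrite (_ : EFin \o _ = fubini_F (lebesgue_rV n) (EFin \o (f \o @rV_cons R n))).
    apply: measurable_fun_fubini_tonelli_F.
      by apply/measurable_EFinP; apply: measurableT_comp => //; exact: measurable_rV_cons.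
    by move=> z; rewrite lee_fin /=; have /andP[] := fM (rV_cons z).
  by apply/funext => s; rewrite /= -integral_slice.
- exists (M * fine (lebesgue_rV n (cube r))) => s; apply/andP; split.
    by apply: Rintegral_ge0 => y _; have /andP[] := fM (rV_cons (s, y)).
  have supp y : ~ cube r y -> f (rV_cons (s, y)) = 0.
    by move=> ry; apply: fr => /cube_rV_cons[].
  rewrite /marginal -(patch_support supp) -Rintegral_mkcond.
  rewrite -Rintegral_cst; last exact: measurable_cube.
  apply: le_Rintegral; first exact: measurable_cube.
  + apply: (bounded_integrable (M := M)); first exact: measurable_cube.
    * exact: cube_finite.
    * exact: measurable_slice.
    * by move=> y _; have /andP[? ?] := fM (rV_cons (s, y)); rewrite ger0_norm.
  + apply: (bounded_integrable (M := `|M|)) => //; first exact: measurable_cube.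
    exact: cube_finite.
  + by move=> y _; have /andP[] := fM (rV_cons (s, y)).
- exists r => // s sr; rewrite /marginal -[RHS](Rintegral_set0 (lebesgue_rV n) (cst 0)).
  rewrite [RHS]Rintegral_mkcond; apply: eq_Rintegral => y _.
  by rewrite patch_set0; apply: fr => /cube_rV_cons[].
Qed.

Lemma Rintegral_marginal n (f : 'rV[R]_n.+1 -> R) : bump_fun (@cube R n.+1) f ->
  \int[lebesgue_rV n.+1]_x f x = \int[mu]_s marginal f s.
Proof.
move=> bf; have [mf [M fM] _] := bf.
rewrite /Rintegral ge0_integral_rVS.
- by congr fine; apply: eq_integral => s _; exact: integral_slice.
- exact/measurable_EFinP.
- by move=> x; rewrite lee_fin; have /andP[] := fM x.
Qed.

(** For two values s and t of the first coordinate, the slices of f at s, of g at t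
    and of h at the midpoint satisfy the hypothesis one dimension lower, so the
    marginals satisfy the hypothesis on the line. *)
Lemma prekopa_leindler n (f g h : 'rV[R]_n -> R) :
  bump_fun (@cube R n) f -> bump_fun (@cube R n) g -> bump_fun (@cube R n) h ->
  (forall x y, f x * g y <= h (2^-1 *: (x + y)) ^+ 2) ->
  (\int[lebesgue_rV n]_x f x) * (\int[lebesgue_rV n]_x g x)
    <= (\int[lebesgue_rV n]_x h x) ^+ 2.
Proof.
elim: n => [|n IH] in f g h *; move=> bf bg bh fgh.
  have int0 (k : 'rV[R]_0 -> R) : bump_fun (@cube R 0) k -> \int[lebesgue_rV 0]_x k x = k 0.
    move=> [mk _ _]; rewrite /Rintegral /= integral_dirac//; last exact/measurable_EFinP.
    by rewrite diracT mul1e.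
  by rewrite !int0//; have := fgh 0 0; rewrite addr0 scaler0.
rewrite !Rintegral_marginal//; apply: prekopa_leindler_line; try exact: bump_marginal.
move=> s t; apply: IH; try exact: bump_slice.
move=> x y; have := fgh (rV_cons (s, x)) (rV_cons (t, y)).
rewrite (_ : 2^-1 *: _ = rV_cons (2^-1 * (s + t), 2^-1 *: (x + y)))//.
apply/rowP => i; case: (unliftP ord0 i) => [j|] ->.
  by rewrite rV_consS/= [LHS]mxE [X in _ * X = _]mxE !rV_consS [RHS]mxE [X in _ = _ * X]mxE.
by rewrite rV_cons0/= [LHS]mxE [X in _ * X = _]mxE !rV_cons0.
Qed.

Lemma prekopa_leindler_set n (A B C : set 'rV[R]_n) (f g h : 'rV[R]_n -> R) (r M : R) :
  measurable A -> measurable B -> measurable C -> 0 <= r ->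
  A `<=` cube r -> B `<=` cube r -> C `<=` cube r ->
  measurable_fun setT f -> measurable_fun setT g -> measurable_fun setT h ->
  (forall x, A x -> 0 <= f x <= M) -> (forall x, B x -> 0 <= g x <= M) ->
  (forall x, C x -> 0 <= h x <= M) ->
  (forall x y, A x -> B y -> C (2^-1 *: (x + y)) /\
     f x * g y <= h (2^-1 *: (x + y)) ^+ 2) ->
  (\int[lebesgue_rV n]_(x in A) f x) * (\int[lebesgue_rV n]_(x in B) g x)
    <= (\int[lebesgue_rV n]_(x in C) h x) ^+ 2.
Proof.
move=> mA mB mC r0 Ar Br Cr mf mg mh fM gM hM fgh.
have bmp (D : set 'rV[R]_n) (k : 'rV[R]_n -> R) : measurable D -> D `<=` cube r ->
    measurable_fun setT k -> (forall x, D x -> 0 <= k x <= M) -> bump_fun (@cube R n) (k \_ D).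
  move=> mD Dr mk kM; split.
  - by apply/(measurable_restrictT _ mD); exact: measurable_funTS.
  - exists `|M| => x; rewrite patchE; case: ifPn => [|_]; last by rewrite lexx normr_ge0.
    by rewrite inE => /kM /andP[-> kx]; rewrite (le_trans kx)// ler_norm.
  - exists r => // x rx; rewrite patchE; case: ifPn => //.
    by rewrite inE => /Dr.
rewrite (Rintegral_mkcond _ A) (Rintegral_mkcond _ B) (Rintegral_mkcond _ C).
apply: prekopa_leindler; [exact: bmp|exact: bmp|exact: bmp|].
move=> x y; rewrite !patchE; case: ifPn => [|_]; last by rewrite mul0r sqr_ge0.
case: ifPn => [|_]; last by rewrite mulr0 sqr_ge0.
by rewrite !inE => By Ax; have [Cz ?] := fgh _ _ Ax By; rewrite mem_set.
Qed.

End prekopa_leindler.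

(** * Compact convex sets and support functions *)

Section separation.
Context {R : realType} {n : nat}.
Implicit Types (x y z theta : 'rV[R]_n) (C : set 'rV[R]_n).

Lemma dotvC x y : dotv x y = dotv y x.
Proof. by apply: eq_bigr => i _; rewrite mulrC. Qed.

Lemma dotvDl x y z : dotv (x + y) z = dotv x z + dotv y z.
Proof. by rewrite -big_split; apply: eq_bigr => i _; rewrite mxE mulrDl. Qed.

Lemma dotvZl (a : R) x z : dotv (a *: x) z = a * dotv x z.
Proof. by rewrite [RHS]big_distrr; apply: eq_bigr => i _; rewrite mxE -mulrA. Qed.

Lemma dotvNl x z : dotv (- x) z = - dotv x z.
Proof. by rewrite -scaleN1r dotvZl mulN1r. Qed.

Lemma dotvBl x y z : dotv (x - y) z = dotv x z - dotv y z.
Proof. by rewrite dotvDl dotvNl. Qed.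

Lemma dotvDr x y z : dotv x (y + z) = dotv x y + dotv x z.
Proof. by rewrite dotvC dotvDl ![dotv _ x]dotvC. Qed.

Lemma dotvBr x y z : dotv x (y - z) = dotv x y - dotv x z.
Proof. by rewrite dotvC dotvBl ![dotv _ x]dotvC. Qed.

Lemma dotvZr (a : R) x z : dotv x (a *: z) = a * dotv x z.
Proof. by rewrite dotvC dotvZl dotvC. Qed.

Lemma dotv_sqrB x y : dotv (x - y) (x - y) = dotv x x - 2 * dotv y x + dotv y y.
Proof. rewrite !dotvBl !dotvBr [dotv x y]dotvC; lra. Qed.

Lemma dotvNr x z : dotv x (- z) = - dotv x z.
Proof. by rewrite dotvC dotvNl dotvC. Qed.

Lemma dotv0l z : dotv 0 z = 0.
Proof. by rewrite -(scale0r z) dotvZl mul0r. Qed.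

Lemma dotvv_ge0 x : 0 <= dotv x x.
Proof. by apply: sumr_ge0 => i _; rewrite -expr2 sqr_ge0. Qed.

Lemma dotvv_gt0 x : x != 0 -> 0 < dotv x x.
Proof.
move=> x0; rewrite lt_neqAle dotvv_ge0 andbT eq_sym; apply: contra_neq x0.
move/eqP; rewrite psumr_eq0 => [/allP x0|i _]; last by rewrite -expr2 sqr_ge0.
apply/rowP => i; rewrite mxE; have /= := x0 i; rewrite mem_index_enum -expr2 sqrf_eq0.
by move=> /(_ isT)/eqP.
Qed.

Lemma sum_continuous (F : 'I_n -> 'rV[R]_n -> R) : (forall i, continuous (F i)) ->
  continuous (fun x => \sum_i F i x).
Proof.
move=> cF; elim: (index_enum _) => [|i s IH] x.
  rewrite (_ : (fun _ => _) = cst 0); first exact: cst_continuous.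
  by apply/funext => y; rewrite big_nil.
rewrite (_ : (fun _ => _) = F i \+ (fun y => \sum_(j <- s) F j y)); last first.
  by apply/funext => y; rewrite big_cons.
by apply: continuousD; [exact: cF|exact: IH].
Qed.

Lemma dotv_continuous z : continuous (dotv ^~ z : 'rV[R]_n -> R).
Proof.
apply: sum_continuous => i x.
by apply: continuousM; [exact: coord_continuous|exact: cst_continuous].
Qed.

Lemma dist2_continuous z : continuous (fun x : 'rV[R]_n => dotv (x - z) (x - z)).
Proof.
apply: sum_continuous => i x.
suff H : {for x, continuous (fun y : 'rV[R]_n => (y - z) ord0 i)} by exact: continuousM.
rewrite (_ : (fun _ => _) = (fun y : 'rV[R]_n => y ord0 i - z ord0 i)).
  by apply: continuousB; [exact: coord_continuous|exact: cst_continuous].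
by apply/funext => y; rewrite !mxE.
Qed.

Lemma convex_setP C x y (t : R) : convex_set C -> C x -> C y -> 0 <= t <= 1 ->
  C (t *: x + (1 - t) *: y).
Proof.
move=> cC Cx Cy /andP[t0 t1]; have := cC x y (Itv01 t0 t1).
by rewrite !inE; apply.
Qed.

(** The separating direction points from the nearest point y0 of C to x: moving
    from y0 towards y by a small t would otherwise decrease the distance to x. *)
Lemma separate_point C x : C !=set0 -> compact C -> convex_set C -> ~ C x ->
  exists2 theta, theta != 0 &
    forall y, C y -> dotv theta y + dotv theta theta <= dotv theta x.
Proof.
move=> C0 cptC cC nCx.
have [y0 /[!inE] Cy0 ymin] := EVT_min_rV C0 cptC
  (continuous_subspaceT (@dist2_continuous x)).
have th0 : x - y0 != 0 by rewrite subr_eq0; apply: contra_not_neq nCx => ->.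
exists (x - y0) => // y Cy.
suff: forall theta, theta = x - y0 ->
  dotv theta y + dotv theta theta <= dotv theta x by exact.
move=> theta thE.
pose d := dotv theta (y - y0); pose D := dotv (y - y0) (y - y0).
have xE : x = theta + y0 by rewrite thE subrK.
suff d0 : d <= 0.
  have -> : dotv theta x = dotv theta theta + dotv theta y0.
    by rewrite [in LHS]xE dotvDr.
  by move: d0; rewrite /d dotvBr; lra.
have D0 : 0 <= D by exact: dotvv_ge0.
rewrite leNgt; apply/negP => dgt0.
have dD0 : 0 < d + D by lra.
(* any t in ]0, 1] with t * D < 2 * d gives a contradiction *)
pose t := d / (d + D).
have t0 : 0 < t by rewrite divr_gt0.
have t1 : t <= 1 by rewrite ler_pdivrMr// mul1r; lra.
have := ymin (t *: y + (1 - t) *: y0).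
rewrite inE => /(_ (convex_setP cC Cy Cy0 _)); rewrite (ltW t0) t1 => /(_ isT).
have -> : t *: y + (1 - t) *: y0 - x = t *: (y - y0) - theta.
  rewrite thE scalerBl scale1r scalerBr opprB addrA addrAC -!addrA.
  by congr (_ + _); rewrite addrCA.
have -> : y0 - x = - theta by rewrite thE opprB.
rewrite !dotvNl dotvNr opprK dotv_sqrB !dotvZl !dotvZr -/D -/d.
move: (dotv theta theta) => e H.
have tdD : t * (d + D) = d by rewrite /t divfK// gt_eqF.
have : 0 <= t * (t * D - 2 * d) by nra.
rewrite pmulr_rge0//; nra.
Qed.

Lemma support_function_ge C theta y : compact C -> C y ->
  dotv theta y <= support_function C theta.
Proof.
move=> cC Cy; apply: sup_upper_bound; last by exists y.
split; first by exists (dotv theta y), y.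
have [y0 _ ymax] := EVT_max_rV (ex_intro _ y Cy) cC
  (continuous_subspaceT (@dotv_continuous theta)).
by exists (dotv y0 theta) => _ [z Cz <-]; rewrite dotvC ymax// inE.
Qed.

Lemma support_function_le C theta M : C !=set0 ->
  (forall y, C y -> dotv theta y <= M) -> support_function C theta <= M.
Proof.
move=> [y Cy] CM; apply: sup_le_ub; first by exists (dotv theta y), y.
by move=> _ [z Cz <-]; exact: CM.
Qed.

(** Only unit directions are assumed, since these are the ones over which a
    floating body is defined. *)
Lemma in_convex_body C x : C !=set0 -> compact C -> convex_set C ->
  (forall theta, unit_sphere theta -> dotv theta x <= support_function C theta) -> C x.
Proof.
move=> C0 cptC cC Hx; apply: contrapT => nCx.
have [theta th0 sep] := separate_point C0 cptC cC nCx.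
have tt := dotvv_gt0 th0.
pose a := (Num.sqrt (dotv theta theta))^-1.
have a0 : 0 < a by rewrite invr_gt0 sqrtr_gt0.
have : unit_sphere (a *: theta).
  rewrite /unit_sphere/= dotvZl dotvC dotvZl mulrA -expr2 exprVn sqr_sqrtr ?mulVf//.
    by rewrite gt_eqF.
  exact: ltW.
move=> /Hx; apply/negP; rewrite -ltNge dotvZl.
apply: (@le_lt_trans _ _ (a * (dotv theta x - dotv theta theta))).
  apply: support_function_le => // y Cy; rewrite dotvZl ler_pM2l//.
  by rewrite lerBrDr sep.
by rewrite ltr_pM2l// gtrBl.
Qed.

End separation.

(** * Tails and moments of the width in a direction *)

Section cauchy_schwarz.
Context {R : realType} d (T : measurableType d) (m : {measure set T -> \bar R}).

Lemma Rintegral_sqr_le (D : set T) (u : T -> R) (M : R) :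
  measurable D -> (m D < +oo)%E -> measurable_fun setT u ->
  (forall x, D x -> `|u x| <= M) ->
  (\int[m]_(x in D) u x) ^+ 2 <= (\int[m]_(x in D) (u x ^+ 2)) * fine (m D).
Proof.
move=> mD Dfin mu uM.
have iu : m.-integrable D (EFin \o u) by exact: (bounded_integrable (M := M)).
have iu2 : m.-integrable D (EFin \o (fun x => u x ^+ 2)).
  apply: (bounded_integrable (M := M ^+ 2)) => //; first exact: measurable_funX.
  by move=> x Dx; rewrite normrX ler_pXn2r// ?nnegrE ?uM// (le_trans _ (uM _ Dx)).
have ic (c : R) : m.-integrable D (EFin \o cst c).
  by apply: (bounded_integrable (M := `|c|)) => //.
have key s : 0 <= (\int[m]_(x in D) (u x ^+ 2)) - 2 * s * (\int[m]_(x in D) u x)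
    + s ^+ 2 * fine (m D).
  have iZ : m.-integrable D (EFin \o (fun x => 2 * s * u x)).
    have : m.-integrable D (fun x => (2 * s)%:E * (EFin \o u) x)%E by exact: integrableZl.
    by apply: eq_integrable.
  have iB : m.-integrable D (EFin \o (fun x => u x ^+ 2 - 2 * s * u x)).
    by have := integrableB mD iu2 iZ; apply: eq_integrable.
  rewrite -Rintegral_cst// -RintegralZl// -RintegralB// -RintegralD//; last exact: (ic (s ^+ 2)).
  apply: Rintegral_ge0 => x _; rewrite (_ : _ + _ = (u x - s) ^+ 2) ?sqr_ge0//.
  by rewrite /=; ring.
move: (\int[m]_(x in D) (u x ^+ 2)) (\int[m]_(x in D) u x) (fine_ge0 (measure_ge0 m D)) key.
move=> I2 I1 m0 key.
have [m00|mn0] := eqVneq (fine (m D)) 0.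
  rewrite m00 mulr0; have [->|I10] := eqVneq I1 0; first by rewrite expr0n.
  have := key ((I2 + 1) / (2 * I1)); rewrite m00 mulr0 addr0.
  rewrite (_ : 2 * _ * I1 = I2 + 1); first lra.
  by field.
have mp : 0 < fine (m D) by rewrite lt_neqAle eq_sym mn0.
have := key (I1 / fine (m D)).
rewrite (_ : _ + _ = I2 - I1 ^+ 2 / fine (m D)); last by field.
by rewrite subr_ge0 ler_pdivrMr.
Qed.

End cauchy_schwarz.

Lemma Rintegral_subset_le {R : realType} d (T : measurableType d)
    (m : {measure set T -> \bar R}) (D E : set T) (f : T -> R) :
  measurable D -> measurable E -> D `<=` E -> m.-integrable E (EFin \o f) ->
  (forall x, E x -> 0 <= f x) ->
  \int[m]_(x in D) f x <= \int[m]_(x in E) f x.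
Proof.
move=> mD mE DE fE f0; have mED : measurable (E `\` D) by exact: measurableD.
rewrite -[in leRHS](setDUK DE) Rintegral_setU//.
- by rewrite lerDl; apply: Rintegral_ge0 => x [/f0].
- by rewrite setDUK.
- by apply/disj_setPS => x [Dx []].
Qed.

Lemma le_powR2 {R : realType} (a b q : R) : 0 <= q -> 0 <= a -> a <= b -> a `^ q <= b `^ q.
Proof. by move=> q0 a0 ab; apply: ge0_ler_powR => //; rewrite nnegrE// (le_trans a0). Qed.

Lemma expR1_ge94 {R : realType} : 9 / 4 <= expR 1 :> R.
Proof.
have h : 3 / 2 <= expR (2^-1) :> R by apply: le_trans (expR_ge1Dx _); lra.
have -> : expR 1 = expR 2^-1 ^+ 2 :> R by rewrite -expRM_natr mulVf.
have -> : 9 / 4 = (3 / 2) ^+ 2 :> R by field.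
by rewrite ler_pXn2r// nnegrE; lra.
Qed.

(** The left-hand side is ((15/7) e^-4)^p, a power of a number less than 1, and
    1 - e^-p increases with p, so p = 1 is the worst case; there e >= 9/4
    suffices: 15/7 (4/9)^4 <= 9/10 (5/9)^4. *)
Lemma tail_constant {R : realType} (p : R) : 1 <= p ->
  (15 / 7) `^ p * expR (- p) ^+ 4 <= 9 / 10 * (1 - expR (- p)) ^+ 4.
Proof.
move=> p1; have e0 := expR_gt0 (1 : R); have e94 := @expR1_ge94 R.
have eN1 : expR (-1) <= 4 / 9 :> R.
  by rewrite expRN -[leRHS]invrK lef_pV2 ?posrE ?invr_gt0; lra.
have eNp : expR (- p) <= 4 / 9 by apply: le_trans eN1; rewrite ler_expR lerN2.
have lnb : ln (15 / 7 : R) <= 4.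
  have -> : 15 / 7 = 1 + 8 / 7 :> R by field.
  by apply: (le_trans (le_ln1Dx _)); lra.
apply: (@le_trans _ _ (15 / 7 * expR (-1) ^+ 4)).
  rewrite /powR ifF; last by apply/eqP; lra.
  rewrite -{2}(@lnK _ (15 / 7 : R)); last by rewrite posrE; lra.
  by rewrite -!expRM_natr -!expRD ler_expR; nra.
have eN0 := expR_gt0 (-1 : R).
apply: (@le_trans _ _ (15 / 7 * (4 / 9) ^+ 4)).
  by rewrite ler_wpM2l ?ler_pXn2r ?nnegrE ?(ltW eN0)//; lra.
apply: (@le_trans _ _ (9 / 10 * (5 / 9) ^+ 4)); first lra.
by rewrite ler_wpM2l ?ler_pXn2r ?nnegrE//; lra.
Qed.

Section moments.
Context {R : realType} {n : nat}.
Variables (K : set 'rV[R]_n) (theta : 'rV[R]_n) (r : R).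
Hypotheses (mK : measurable K) (r0 : 0 <= r) (Kr : K `<=` cube r).
Hypotheses (cK : convex_set K) (K1 : lebesgue_rV n K = 1%:E).
Local Notation mu := (lebesgue_rV n).
Let S (x : 'rV[R]_n) : R := `|dotv x theta|.

Definition slab (t : R) : set 'rV[R]_n := K `&` [set x | S x <= t].
Definition tail (t : R) : set 'rV[R]_n := K `&` [set x | t < S x].

Let S_ge0 x : 0 <= S x. Proof. exact: normr_ge0. Qed.

Lemma measurable_width : measurable_fun setT S.
Proof. by apply: measurableT_comp => //; exact: measurable_dotv. Qed.

Lemma measurable_tail t : measurable (tail t).
Proof. by apply: measurableI => //; apply: measurable_superlevel; exact: measurable_width. Qed.

Lemma slabE t : slab t = K `\` tail t.
Proof.
apply/seteqP; split=> x [Kx]; first by move=> St; split=> // -[_] /=; rewrite ltNge St.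
by move=> H; split=> //=; rewrite leNgt; apply/negP => tS; apply: H.
Qed.

Lemma measurable_slab t : measurable (slab t).
Proof. by rewrite slabE; apply: measurableD => //; exact: measurable_tail. Qed.

Lemma sub_finite D : measurable D -> D `<=` K -> (mu D < +oo)%E.
Proof.
move=> mD DK; apply: (@le_lt_trans _ _ (mu K)); last by rewrite K1 ltry.
by apply: le_measure; rewrite ?inE.
Qed.

Lemma tail_finite t : (mu (tail t) < +oo)%E.
Proof. by apply: sub_finite; [exact: measurable_tail|exact: subIsetl]. Qed.

Lemma slab_finite t : (mu (slab t) < +oo)%E.
Proof. by apply: sub_finite; [exact: measurable_slab|exact: subIsetl]. Qed.

Lemma slab_tail t : fine (mu (slab t)) + fine (mu (tail t)) = 1.
Proof.
have mt := measurable_tail t; have ms := measurable_slab t.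
rewrite -fineD ?ge0_fin_numE ?tail_finite ?slab_finite// -measureU//.
  by rewrite slabE setUC setDUK; [exact: (congr1 fine K1)|exact: subIsetl].
by rewrite slabE setDE -setIA setICl setI0.
Qed.

Lemma convex_midpoint x y : K x -> K y -> K (2^-1 *: (x + y)).
Proof.
move=> Kx Ky; have := @convex_setP _ _ _ x y 2^-1 cK Kx Ky.
rewrite (_ : 1 - 2^-1 = 2^-1 :> R); last lra.
by rewrite -scalerDr; apply; apply/andP; split; lra.
Qed.

Lemma width_midpoint x y : (S x - S y) / 2 <= S (2^-1 *: (x + y)).
Proof.
rewrite /S dotvZl dotvDl normrM ger0_norm; last lra.
by have := lerB_normD (dotv x theta) (dotv y theta); lra.
Qed.

Lemma width_bounded : exists2 M, 0 < M & forall x, K x -> S x <= M.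
Proof.
exists (1 + \sum_i (r * `|theta ord0 i|)).
  by rewrite ltr_pwDl// sumr_ge0// => i _; rewrite mulr_ge0.
move=> x Kx; apply: (@le_trans _ _ (\sum_i (r * `|theta ord0 i|))); last by rewrite lerDr.
apply: (le_trans (ler_norm_sum _ _ _)); apply: ler_sum => i _.
by rewrite normrM ler_wpM2r//; exact: Kr.
Qed.

Lemma powR_width_integrable q D : 0 <= q -> measurable D -> D `<=` K ->
  mu.-integrable D (EFin \o (fun x => S x `^ q)).
Proof.
move=> q0 mD DK; have [M M0 SM] := width_bounded.
apply: (bounded_integrable (M := M `^ q)) => //; first exact: sub_finite.
  apply: (measurableT_comp (measurable_powR _)) => //; exact: measurable_width.
move=> x Dx; rewrite ger0_norm ?powR_ge0//.
by apply: le_powR2 => //; exact/SM/DK.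
Qed.

(** The midpoint of a point with S > 2 s + t and a point with S <= t has
    S > s. *)
Lemma tail_doubling (s t : R) :
  fine (mu (tail (2 * s + t))) * fine (mu (slab t)) <= fine (mu (tail s)) ^+ 2.
Proof.
rewrite -!(Rintegral1 mu); [|exact: measurable_tail|exact: measurable_slab|exact: measurable_tail].
apply: (prekopa_leindler_set (r := r) (M := 1)) => //.
- exact: measurable_tail.
- exact: measurable_slab.
- exact: measurable_tail.
- by move=> x [/Kr].
- by move=> x [/Kr].
- by move=> x [/Kr].
- by move=> x _; rewrite ler01 lexx.
- by move=> x _; rewrite ler01 lexx.
- by move=> x _; rewrite ler01 lexx.
move=> x y [Kx /= sx] [Ky /= yt]; rewrite /cst mul1r expr1n; split=> //; split.
  exact: convex_midpoint.
by apply: lt_le_trans (width_midpoint x y); lra.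
Qed.

(** The weighted version: if S x > 15 t and S y <= t, the midpoint z has
    S z >= (S x - S y) / 2 >= 7/15 S x > 7 t, so S^p at x is controlled by the
    square of ((15/7) S)^(p/2) at z; the Cauchy-Schwarz inequality splits the
    square of the resulting integral. *)
Lemma tail_moment (t p : R) : 0 < t -> 0 < p ->
  \int[mu]_(x in tail (15 * t)) (S x `^ p) * fine (mu (slab t)) <=
  (15 / 7) `^ p * (\int[mu]_(x in tail (7 * t)) (S x `^ p)) * fine (mu (tail (7 * t))).
Proof.
move=> t0 p0; have [M M0 SM] := width_bounded.
have bS : 0 <= (15 / 7 : R) by lra.
pose h x := (15 / 7 * S x) `^ (p / 2).
have h2 x : h x ^+ 2 = (15 / 7) `^ p * S x `^ p.
  by rewrite /h -powR_mulrn ?powR_ge0// -powRrM divfK// powRM ?normr_ge0.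
have mh : measurable_fun setT h.
  apply: (measurableT_comp (measurable_powR _)) => //.
  by apply: measurable_funM => //; exact: measurable_width.
have mS : measurable_fun setT (fun x => S x `^ p).
  by apply: (measurableT_comp (measurable_powR _)) => //; exact: measurable_width.
have hM x : K x -> 0 <= h x <= (15 / 7 * M) `^ (p / 2).
  move=> Kx; rewrite powR_ge0/=; apply: le_powR2; [by rewrite divr_ge0// ltW|exact: mulr_ge0|].
  by rewrite ler_wpM2l// SM.
apply: (@le_trans _ _ ((\int[mu]_(x in tail (7 * t)) h x) ^+ 2)).
  rewrite -(Rintegral1 mu); last exact: measurable_slab.
  pose B := Num.max 1 (Num.max (M `^ p) ((15 / 7 * M) `^ (p / 2))).
  apply: (prekopa_leindler_set (r := r) (M := B)) => //.
  - exact: measurable_tail.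
  - exact: measurable_slab.
  - exact: measurable_tail.
  - by move=> x [/Kr].
  - by move=> x [/Kr].
  - by move=> x [/Kr].
  - move=> x [Kx _]; rewrite powR_ge0/= !le_max; apply/orP; right; apply/orP; left.
    by apply: le_powR2; [exact: ltW|exact: S_ge0|exact: SM].
  - by move=> x _; rewrite ler01/= le_max lexx.
  - by move=> x [/hM /andP[-> hx] _]; rewrite /= !le_max hx !orbT.
  move=> x y [Kx /= sx] [Ky /= yt]; have mid := width_midpoint x y; split; first split.
  - exact: convex_midpoint.
  - by rewrite /=; apply: lt_le_trans mid; lra.
  rewrite /cst mulr1 h2 -powRM//; apply: le_powR2; [exact: ltW|exact: S_ge0|].
  by apply: (@le_trans _ _ (15 / 7 * ((S x - S y) / 2))); [lra|rewrite ler_wpM2l].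
have := @Rintegral_sqr_le _ _ _ mu (tail (7 * t)) h ((15 / 7 * M) `^ (p / 2))
  (measurable_tail _) (tail_finite _) mh.
move=> /(_ _)/le_trans; apply.
  by move=> x [/hM /andP[h0 hx] _]; rewrite ger0_norm.
rewrite ler_wpM2r ?fine_ge0//.
under eq_Rintegral do rewrite h2.
rewrite RintegralZl//; first exact: measurable_tail.
by apply: powR_width_integrable; [exact: ltW|exact: measurable_tail|exact: subIsetl].
Qed.

Lemma Rintegral_tail_le p b : 0 <= p ->
  \int[mu]_(x in tail b) (S x `^ p) <= \int[mu]_(x in K) (S x `^ p).
Proof.
move=> p0; apply: Rintegral_subset_le; first exact: measurable_tail.
- exact: mK.
- exact: subIsetl.
- exact: powR_width_integrable.
- by move=> x _; exact: powR_ge0.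
Qed.

Lemma Rintegral_slab_tail p b : 0 <= p ->
  \int[mu]_(x in K) (S x `^ p) =
  \int[mu]_(x in slab b) (S x `^ p) + \int[mu]_(x in tail b) (S x `^ p).
Proof.
move=> p0; have mt := measurable_tail b.
have KE : K = slab b `|` tail b.
  by rewrite slabE setUC setDUK//; exact: subIsetl.
rewrite [in LHS]KE Rintegral_setU//.
- exact: measurable_slab.
- by rewrite -KE; exact: powR_width_integrable.
- by apply/disj_setPS; rewrite slabE => x [[_ H] /H].
Qed.

(** Doubling takes the level t to 3 t and then to 7 t, and the weighted step takes
    7 t to 15 t; together they bound the part of the moment above 15 t by 9/10 of
    the whole moment, which can then be absorbed. *)
Lemma moment_le (t p : R) : 0 < t -> 1 <= p ->
  fine (mu (slab t)) = 1 - expR (- p) ->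
  \int[mu]_(x in K) (S x `^ p) <= (150 * t) `^ p.
Proof.
move=> t0 p1 st; have p0 : 0 < p by exact: lt_le_trans p1.
set I := \int[mu]_(x in K) _.
have I0 : 0 <= I by apply: Rintegral_ge0 => x _; exact: powR_ge0.
have tt : fine (mu (tail t)) = expR (- p) by have := slab_tail t; rewrite st; lra.
have h3 := tail_doubling t t.
have h7 := tail_doubling (3 * t) t.
have h15 := tail_moment t0 p0.
have J7 : \int[mu]_(x in tail (7 * t)) (S x `^ p) <= I.
  by apply: Rintegral_tail_le; exact: ltW.
have := Rintegral_slab_tail (15 * t) (ltW p0).
have J15 : \int[mu]_(x in slab (15 * t)) (S x `^ p) <= (15 * t) `^ p.
  rewrite -[leRHS]mulr1.
  apply: (@le_trans _ _ ((15 * t) `^ p * fine (mu (slab (15 * t))))); last first.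
    rewrite ler_wpM2l ?powR_ge0//; have := slab_tail (15 * t).
    have := fine_ge0 (measure_ge0 mu (tail (15 * t))); lra.
  rewrite -Rintegral_cst; last exact: measurable_slab.
  have ms := measurable_slab (15 * t).
  apply: le_Rintegral => //.
  - apply: powR_width_integrable; [exact: ltW|exact: ms|exact: subIsetl].
  - apply: (bounded_integrable (M := `|(15 * t) `^ p|)) => //; exact: slab_finite.
  - by move=> x [_ St]; apply: le_powR2 => //; exact: ltW.
rewrite -/I => IE.
have cst := tail_constant p1.
move: h3 h7 h15 J7 J15 IE cst.
rewrite st tt (_ : 2 * t + t = 3 * t); last by ring.
rewrite (_ : 2 * (3 * t) + t = 7 * t); last by ring.
have b0 : 0 <= (15 / 7) `^ p by exact: powR_ge0.
have e0 := expR_gt0 (- p).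
have d1 : expR (- p) < 1 by rewrite -expR0 ltr_expR; lra.
have P30 := fine_ge0 (measure_ge0 mu (tail (3 * t))).
have P70 := fine_ge0 (measure_ge0 mu (tail (7 * t))).
set b := (15 / 7) `^ p in b0 *; set d := expR _ in e0 d1 *.
set P3 := fine (mu (tail (3 * t))) in P30 *; set P7 := fine (mu (tail (7 * t))) in P70 *.
set J := \int[mu]_(x in tail (7 * t)) _; set J' := \int[mu]_(x in tail (15 * t)) _.
set L := \int[mu]_(x in slab _) _.
move=> h3 h7 h15 J7 J15 IE cst.
have a0 : 0 < 1 - d by lra.
set a := 1 - d in h3 h7 h15 cst a0.
have P3a : (P3 * a) ^+ 2 <= d ^+ 4.
  rewrite (_ : d ^+ 4 = (d ^+ 2) ^+ 2); last by rewrite -exprM.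
  by rewrite ler_pXn2r// nnegrE ?sqr_ge0// mulr_ge0// ltW.
have P7a : P7 * a ^+ 3 <= d ^+ 4.
  apply: le_trans P3a; rewrite exprMn (_ : _ * _ = P7 * a * a ^+ 2); last by ring.
  by rewrite ler_wpM2r// sqr_ge0.
have J'a : J' * a ^+ 4 <= 9 / 10 * I * a ^+ 4.
  apply: (@le_trans _ _ (b * J * P7 * a ^+ 3)).
    rewrite (_ : J' * _ = J' * a * a ^+ 3); last by ring.
    by rewrite ler_wpM2r// exprn_ge0// ltW.
  apply: (@le_trans _ _ (b * I * (P7 * a ^+ 3))).
    rewrite -!mulrA ler_wpM2l// ler_wpM2r// mulr_ge0// exprn_ge0// ltW//.
  apply: (@le_trans _ _ (b * I * d ^+ 4)).
    by rewrite ler_wpM2l// mulr_ge0.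
  rewrite (_ : b * _ * _ = (b * d ^+ 4) * I); last by ring.
  rewrite (_ : 9 / 10 * _ * _ = (9 / 10 * a ^+ 4) * I); last by ring.
  by rewrite ler_wpM2r.
have {}J'a : J' <= 9 / 10 * I by rewrite -(ler_pM2r (exprn_gt0 4 a0)).
have I10 : I <= 10 * (15 * t) `^ p by lra.
apply: (le_trans I10).
rewrite (_ : 150 * t = 10 * (15 * t)); last by ring.
rewrite [in leRHS]powRM; [|lra|lra].
rewrite ler_wpM2r ?powR_ge0//; apply: le1r_powR => //; lra.
Qed.

Lemma markov_width (t p : R) : 0 < t -> 0 <= p ->
  t `^ p * fine (mu (tail t)) <= \int[mu]_(x in K) (S x `^ p).
Proof.
move=> t0 p0; apply: (le_trans _ (Rintegral_tail_le t p0)).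
have mt := measurable_tail t.
rewrite -Rintegral_cst; last exact: mt.
apply: le_Rintegral => //.
- apply: (bounded_integrable (M := `|t `^ p|)) => //; exact: tail_finite.
- by apply: powR_width_integrable => //; exact: subIsetl.
- by move=> x [_ /ltW St]; apply: le_powR2 => //; exact: ltW.
Qed.

Lemma slab_mono s t : s <= t -> fine (mu (slab s)) <= fine (mu (slab t)).
Proof.
move=> st; apply: fine_le.
- by rewrite ge0_fin_numE// slab_finite.
- by rewrite ge0_fin_numE// slab_finite.
- apply: le_measure; rewrite ?inE; [exact: measurable_slab|exact: measurable_slab|].
  by move=> x [Kx Sx]; split => //=; exact: le_trans st.
Qed.

(** The level is the supremum tau of the levels at which the slab has mass at most
    v.  The slab at tau is the intersection of the larger slabs and, up to the null
    set {S = tau}, the union of the smaller ones. *)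
Lemma slab_attains (v : R) : theta != 0 -> 0 < v < 1 ->
  exists2 t, 0 < t & fine (mu (slab t)) = v.
Proof.
move=> th0 /andP[v0 v1].
have muV t : mu (slab t) = (fine (mu (slab t)))%:E.
  by rewrite fineK// ge0_fin_numE// slab_finite.
have null t : mu (K `&` [set x | S x = t]) = 0%E.
  apply/eqP; rewrite eq_le measure_ge0 andbT.
  have mE c : measurable [set x : 'rV[R]_n | dotv x theta = c].
    have := @measurable_dotv _ _ theta measurableT [set c] (measurable_set1 c).
    by rewrite setTI.
  apply: (@le_trans _ _ (mu ([set x | dotv x theta = t] `|` [set x | dotv x theta = - t]))).
    apply: le_measure; rewrite ?inE.
    - apply: measurableI => //.
      have := @measurable_width measurableT [set t] (measurable_set1 t).
      by rewrite setTI.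
    - exact: measurableU.
    - move=> x [_]; rewrite /= /S => <-.
      have [x0|x0] := leP 0 (dotv x theta); [left|right]; rewrite /=; first by rewrite ger0_norm.
      by rewrite ltr0_norm ?opprK.
  apply: le_trans (measureU2 _ (mE _) (mE _)) _.
  rewrite [X in (X + _)%E](hyperplane_null _ th0) [X in (_ + X)%E](hyperplane_null _ th0).
  by rewrite adde0.
have V0 : fine (mu (slab 0)) = 0.
  suff -> : mu (slab 0) = 0%E by [].
  rewrite -(null 0); congr (mu _); apply/seteqP; split=> x [Kx Sx]; split=> //=.
    by apply/eqP; rewrite eq_le S_ge0 andbT.
  by move: Sx => /= ->.
have [M M0 SM] := width_bounded.
have VM : fine (mu (slab M)) = 1.
  rewrite (_ : slab M = K) ?K1//; apply/seteqP; split=> [x []//|x Kx].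
  by split => //; exact: SM.
pose T := [set t | fine (mu (slab t)) <= v].
have hT : has_sup T.
  split; first by exists 0; rewrite /T/= V0 ltW.
  exists M => t; rewrite /T/= => Vt; rewrite leNgt; apply/negP => Mt.
  by have := slab_mono (ltW Mt); rewrite VM; lra.
pose tau := sup T.
have above t : tau < t -> v < fine (mu (slab t)).
  move=> taut; rewrite ltNge; apply/negP => Vt.
  have : t <= tau by apply: sup_upper_bound.
  by rewrite leNgt taut.
have below t : t < tau -> fine (mu (slab t)) <= v.
  move=> ttau; have e0 : 0 < tau - t by rewrite subr_gt0.
  have [s Ts] := sup_adherent e0 hT; rewrite -/tau subKr => ts.
  by apply: le_trans (slab_mono (ltW ts)) _.
have geV : v <= fine (mu (slab tau)).
  pose F (k : nat) := slab (tau + k.+1%:R^-1).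
  have FE : \bigcap_k F k = slab tau.
    apply/seteqP; split=> [x Fx|x [Kx Sx] k _]; last first.
      by split=> //=; rewrite (le_trans Sx)// lerDl.
    split; first by have [] := Fx 0%N I.
    rewrite /= leNgt; apply/negP => /ltr_add_invr[k].
    by have [_ /=] := Fx k I; rewrite leNgt => /negP.
  have := @nonincreasing_cvg_mu _ _ _ mu F.
  rewrite FE => /(_ (slab_finite _) (fun=> measurable_slab _) (measurable_slab _))/(_ _)H.
  rewrite -lee_fin -muV; apply: (cvge_ge _ (H _)); last first.
    move=> i j ij; apply/subsetPset => x [Kx Sx]; split=> //=.
    by rewrite (le_trans Sx)// lerD2l lef_pV2 ?posrE// ler_nat.
  by apply: nearW => k; rewrite /= muV lee_fin ltW// above// ltrDl.
have leV : fine (mu (slab tau)) <= v.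
  pose F (k : nat) := slab (tau - k.+1%:R^-1).
  have mU : measurable (\bigcup_k F k) by apply: bigcupT_measurable => k; exact: measurable_slab.
  have FE : slab tau = (\bigcup_k F k) `|` (K `&` [set x | S x = tau]).
    apply/seteqP; split=> [x [Kx Sx]|x [[k _ [Kx Sx]]|[Kx Sx]]].
    - move: Sx; rewrite /= le_eqVlt => /predU1P[Sx|Sx]; first by right.
      left; have /ltr_add_invr[k kx] := Sx; exists k => //; split=> //=.
      by rewrite lerBrDr ltW.
    - by split=> //=; rewrite (le_trans Sx)// gerDl oppr_le0.
    - by split=> //=; rewrite Sx.
  rewrite -lee_fin -muV FE; apply: le_trans (measureU2 _ mU _) _.
    apply: measurableI => //.
    have := @measurable_width measurableT [set tau] (measurable_set1 tau).
    by rewrite setTI.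
  rewrite [X in (_ + X)%E]null adde0.
  have := @nondecreasing_cvg_mu _ _ _ mu F.
  move=> /(_ (fun=> measurable_slab _) mU)/(_ _)H.
  apply: (cvge_le _ (H _)); last first.
    move=> i j ij; apply/subsetPset => x [Kx Sx]; split=> //=.
    by rewrite (le_trans Sx)// lerD2l lerN2 lef_pV2 ?posrE// ler_nat.
  by apply: nearW => k; rewrite /= muV lee_fin below// gtrDl oppr_lt0.
exists tau; last by apply/eqP; rewrite eq_le leV.
rewrite ltNge; apply/negP => tau0.
by have := slab_mono tau0; rewrite V0; lra.
Qed.

End moments.

Lemma powRK {R : realType} (a p : R) : 0 <= a -> p != 0 -> (a `^ p^-1) `^ p = a.
Proof. by move=> a0 p0; rewrite -powRrM mulVf// powRr1. Qed.

(** Young's inequality, in a form that also covers the exponent p = 1, whose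
    conjugate exponent is infinite. *)
Lemma young_powR {R : realType} (u v p : R) : 0 <= u -> 0 <= v -> 1 <= p ->
  u `^ (p - 1) * v <= (1 - p^-1) * u `^ p + p^-1 * v `^ p.
Proof.
move=> u0 v0; rewrite le_eqVlt => /predU1P[<-|p1].
  by rewrite subrr powRr0 invr1 subrr mul0r add0r !mul1r powRr1.
have p0 : 0 < p by lra.
have pm1 : 0 < p - 1 by lra.
have := @conjugate_powR _ v (u `^ (p - 1)) p (p / (p - 1)) v0 (powR_ge0 _ _) p0.
rewrite -powRrM (_ : (p - 1) * (p / (p - 1)) = p); last by field; lra.
have q0 : 0 < p / (p - 1) by rewrite divr_gt0.
have pq : p^-1 + (p / (p - 1))^-1 = 1 by field; lra.
move=> /(_ q0 pq); rewrite mulrC => /le_trans; apply.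
rewrite addrC (_ : (p / (p - 1))^-1 = 1 - p^-1); last by lra.
by rewrite mulrC [p^-1 * _]mulrC.
Qed.

Lemma Rintegral_sum {R : realType} d (T : measurableType d) (m : {measure set T -> \bar R})
    (I : Type) (s : seq I) (D : set T) (F : I -> T -> R) : measurable D ->
  (forall i, m.-integrable D (EFin \o F i)) ->
  m.-integrable D (EFin \o (fun x => \sum_(i <- s) F i x)) /\
  \int[m]_(x in D) (\sum_(i <- s) F i x) = \sum_(i <- s) \int[m]_(x in D) F i x.
Proof.
move=> mD iF; elim: s => [|i s [IH1 IH2]].
  split.
    rewrite (_ : _ \o _ = cst 0%E); first exact: integrable0.
    by apply/funext => x /=; rewrite big_nil.
  rewrite big_nil; under eq_Rintegral do rewrite big_nil.
  by rewrite Rintegral_cst// mul0r.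
split.
  rewrite (_ : _ \o _ = (EFin \o F i) \+ (EFin \o (fun x => \sum_(i <- s) F i x))).
    exact: integrableD.
  by apply/funext => x /=; rewrite big_cons.
under eq_Rintegral do rewrite big_cons.
by rewrite RintegralD// IH2 big_cons.
Qed.

Lemma powR_div {R : realType} (u h q : R) : 0 <= u -> 0 < h -> (u / h) `^ q = u `^ q / h `^ q.
Proof.
move=> u0 h0; have hq : h `^ q != 0 by rewrite gt_eqF// powR_gt0.
by apply: (mulIf hq); rewrite divfK// -powRM ?divr_ge0 ?(ltW h0)// divfK// gt_eqF.
Qed.

(** [young_powR] at u / h and v / h', with the normalization cleared; when h and h'
    are L_p norms, integrating it gives Holder's inequality. *)
Lemma weighted_young {R : realType} (u v h h' p : R) :
  0 <= u -> 0 <= v -> 0 < h -> 0 < h' -> 1 <= p ->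
  u `^ (p - 1) * v <= h `^ (p - 1) * h' * (1 - p^-1) / h `^ p * u `^ p
     + h `^ (p - 1) * h' * p^-1 / h' `^ p * v `^ p.
Proof.
move=> u0 v0 h0 h'0 p1.
have uh : 0 <= u / h by rewrite divr_ge0// ltW.
have vh : 0 <= v / h' by rewrite divr_ge0// ltW.
have := young_powR uh vh p1; rewrite !powR_div//.
have : 0 < h `^ (p - 1) by rewrite powR_gt0.
have : 0 < h `^ p by rewrite powR_gt0.
have : 0 < h' `^ p by rewrite powR_gt0.
move: (u `^ (p - 1)) (u `^ p) (v `^ p) (h `^ (p - 1)) (h `^ p) (h' `^ p).
move=> u1 up vp h1 hp hp' hp'0 hp0 h10; have hh : 0 < h1 * h' by rewrite mulr_gt0.
rewrite -(ler_pM2l hh) => H.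
rewrite [leLHS](_ : _ = h1 * h' * (u1 / h1 * (v / h'))); last first.
  by field; rewrite !gt_eqF.
rewrite [leRHS](_ : _ = h1 * h' * ((1 - p^-1) * (up / hp) + p^-1 * (vp / hp')))//.
by field; rewrite !gt_eqF//; lra.
Qed.

(** * Existence of the L_p centroid body *)

Section centroid.
Context {R : realType} {n : nat}.
Variables (K : set 'rV[R]_n) (r rho p : R).
Hypotheses (mK : measurable K) (r0 : 0 <= r) (Kr : K `<=` cube r).
Hypotheses (K1 : lebesgue_rV n K = 1%:E) (rho0 : 0 < rho) (rhoK : cube rho `<=` K).
Hypothesis p1 : 1 <= p.
Local Notation mu := (lebesgue_rV n).
Implicit Types theta y : 'rV[R]_n.

Let p0 : 0 < p. Proof. exact: lt_le_trans p1. Qed.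

Definition moment theta : R := \int[mu]_(x in K) (`|dotv x theta| `^ p).
Definition Lp_width theta : R := moment theta `^ p^-1.

Let integrable_moment theta : mu.-integrable K (EFin \o (fun x => `|dotv x theta| `^ p)).
Proof. by apply: (powR_width_integrable theta mK r0 Kr K1) => //; exact: ltW. Qed.

Lemma moment_ge0 theta : 0 <= moment theta.
Proof. by apply: Rintegral_ge0 => x _; exact: powR_ge0. Qed.

Lemma Lp_width_ge0 theta : 0 <= Lp_width theta.
Proof. exact: powR_ge0. Qed.

Lemma Lp_widthX theta : Lp_width theta `^ p = moment theta.
Proof. by rewrite powRK ?moment_ge0// gt_eqF. Qed.

(** On the part Q of the cube where every coordinate has the sign of the one of
    theta and is at least rho / 2 in size, the terms of <x, theta> add up without
    cancellation; Q has volume (rho / 2)^n. *)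
Lemma Lp_width_coercive : exists2 c, 0 < c &
  forall theta, c * \sum_i `|theta ord0 i| <= Lp_width theta.
Proof.
have v0 : 0 < (rho / 2) ^+ n by rewrite exprn_gt0// divr_gt0.
exists (rho / 2 * ((rho / 2) ^+ n) `^ p^-1).
  by rewrite mulr_gt0 ?divr_gt0// powR_gt0.
move=> theta; pose N := \sum_i `|theta ord0 i|.
have N0 : 0 <= N by apply: sumr_ge0.
pose a : 'rV[R]_n := \row_i (if 0 <= theta ord0 i then rho / 2 else - rho).
pose b : 'rV[R]_n := \row_i (if 0 <= theta ord0 i then rho else - (rho / 2)).
pose Q := [set v : 'rV[R]_n | forall i, a ord0 i <= v ord0 i <= b ord0 i].
have rhop : (0 : R) < rho := rho0.
have rho2 : rho / 2 <= rho by lra.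
have muQ : mu Q = ((rho / 2) ^+ n)%:E.
  rewrite lebesgue_rV_box => [|i]; last by rewrite !mxE; case: ifP => _; lra.
  rewrite (eq_bigr (fun=> rho / 2)) ?prodr_const ?card_ord// => i _.
  by rewrite !mxE; case: ifP => _; lra.
have Qfin : (mu Q < +oo)%E by rewrite muQ ltry.
have QK : Q `<=` K.
  move=> x Qx; apply: rhoK => i; have := Qx i; rewrite !mxE ler_norml.
  by case: ifP => _ /andP[? ?]; lra.
have mQ : measurable Q.
  apply: (@measurable_coordwise R n (fun i => [set u | a ord0 i <= u <= b ord0 i])) => i.
  by rewrite -set_itvcc; exact: measurable_itv.
have QN x : Q x -> rho / 2 * N <= `|dotv x theta|.
  move=> Qx; apply: le_trans (ler_norm _); rewrite mulr_sumr; apply: ler_sum => i _.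
  have := Qx i; rewrite !mxE; case: ifPn => [t0|].
    by move=> /andP[xl _]; rewrite ger0_norm// ler_wpM2r.
  rewrite -ltNge => t0 /andP[_ xl]; rewrite ltr0_norm// mulrN -mulNr.
  by apply: ler_wnM2r => //; exact: ltW.
have : (rho / 2 * N) `^ p * (rho / 2) ^+ n <= moment theta.
  apply: (@le_trans _ _ (\int[mu]_(x in Q) (`|dotv x theta| `^ p))); last first.
    apply: Rintegral_subset_le => // x _; exact: powR_ge0.
  have -> : (rho / 2) ^+ n = fine (mu Q) by rewrite muQ.
  rewrite -Rintegral_cst; last exact: mQ.
  apply: le_Rintegral; first exact: mQ.
  - exact: (bounded_integrable (M := `|(rho / 2 * N) `^ p|)).
  - apply: integrableS (integrable_moment theta) => //.
  - move=> x Qx; apply: le_powR2; [exact: ltW| |exact: QN].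
    by rewrite mulr_ge0// divr_ge0// ltW.
move=> H; rewrite mulrAC -/N.
rewrite (_ : rho / 2 * N = ((rho / 2 * N) `^ p) `^ p^-1); last first.
  by rewrite -powRrM divff ?gt_eqF// powRr1// mulr_ge0// divr_ge0// ltW.
rewrite -powRM ?powR_ge0 ?(ltW v0)//.
apply: le_powR2 => //; first by rewrite invr_ge0 ltW.
by rewrite mulr_ge0 ?powR_ge0 ?(ltW v0).
Qed.

Definition centroid_set : set 'rV[R]_n := [set y | forall theta, dotv theta y <= Lp_width theta].

(** Away from <x, theta> = 0, the derivative of |<x, theta>|^p with respect to
    theta is p times this weight times x; at <x, theta> = 0 the second factor makes
    the weight vanish for every p. *)
Let weight theta (x : 'rV[R]_n) : R := `|dotv x theta| `^ (p - 2) * dotv x theta.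

Let weight_norm theta x : `|weight theta x| <= `|dotv x theta| `^ (p - 1).
Proof.
rewrite /weight; have [->|a0] := eqVneq (dotv x theta) 0.
  by rewrite mulr0 normr0 powR_ge0.
rewrite normrM ger0_norm ?powR_ge0// -[X in _ * X]powRr1//.
rewrite -powRD; last by rewrite normr_eq0 a0 implybT.
by rewrite (_ : p - 2 + 1 = p - 1)//; lra.
Qed.

Let weight_mul theta x : weight theta x * dotv x theta = `|dotv x theta| `^ p.
Proof.
rewrite /weight; have [->|a0] := eqVneq (dotv x theta) 0.
  by rewrite !mulr0 normr0 powR0// gt_eqF.
rewrite -mulrA -expr2 -real_normK ?num_real// -powR_mulrn// -powRD.
  by rewrite (_ : p - 2 + 2%:R = p)//; lra.
by rewrite normr_eq0 a0 implybT.
Qed.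

Let integrable_weight theta (k : 'rV[R]_n -> R) (N : R) : measurable_fun setT k ->
  (forall x, K x -> `|k x| <= N) -> mu.-integrable K (EFin \o (fun x => weight theta x * k x)).
Proof.
move=> mk kN; have [M M0 SM] := width_bounded theta r0 Kr.
have muK : (mu K < +oo)%E by rewrite K1 ltry.
apply: (bounded_integrable (M := M `^ (p - 1) * N)) => //.
  apply: measurable_funM => //; apply: measurable_funM; last exact: measurable_dotv.
  apply: (measurableT_comp (measurable_powR _)) => //.
  by apply: measurableT_comp => //; exact: measurable_dotv.
move=> x Kx; rewrite normrM ler_pM// ?kN//.
apply: le_trans (weight_norm _ _) _; apply: le_powR2 => //; last exact: SM.
by rewrite subr_ge0.
Qed.

Let integrable_weight_coord theta i :
  mu.-integrable K (EFin \o (fun x => weight theta x * x ord0 i)).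
Proof.
apply: (@integrable_weight theta (fun x => x ord0 i) r); first exact: measurable_rV_coord.
by move=> x /Kr; exact.
Qed.

(** The contact point is the gradient of the L_p norm at theta.  It lies in every
    half-space by Holder's inequality, here obtained by integrating
    [weighted_young], and Holder's inequality is an equality in the direction
    theta itself. *)
Lemma contact_point theta : 0 < Lp_width theta ->
  exists2 y, centroid_set y & dotv theta y = Lp_width theta.
Proof.
move=> h0; set h := Lp_width theta in h0 *.
pose y : 'rV[R]_n := \row_i ((h `^ (p - 1))^-1 * \int[mu]_(x in K) (weight theta x * x ord0 i)).
have hp0 : 0 < h `^ (p - 1) by rewrite powR_gt0.
have yE eta : dotv eta y =
    (h `^ (p - 1))^-1 * \int[mu]_(x in K) (weight theta x * dotv x eta).
  transitivity ((h `^ (p - 1))^-1 *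
      \sum_i \int[mu]_(x in K) (eta ord0 i * (weight theta x * x ord0 i))).
    rewrite mulr_sumr; apply: eq_bigr => i _; rewrite mxE mulrCA; congr (_ * _).
    by rewrite RintegralZl.
  congr (_ * _).
  have := @Rintegral_sum _ _ _ mu _ (index_enum 'I_n) K
    (fun i x => eta ord0 i * (weight theta x * x ord0 i)) mK.
  case=> [i|_ <-].
    have : mu.-integrable K (fun x => (eta ord0 i)%:E *
        (EFin \o (fun x => (weight theta x * x ord0 i)%R)) x)%E.
      by apply: integrableZl => //; exact: integrable_weight_coord.
    by apply: eq_integrable.
  apply: eq_Rintegral => x _; rewrite mulr_sumr; apply: eq_bigr => i _.
  by rewrite mulrCA [X in _ * X]mulrC.
have hX : h `^ p = moment theta by exact: Lp_widthX.
have hpE : h `^ p = h `^ (p - 1) * h by rewrite mulrC mulr_powRB1// ltW.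
exists y; last first.
  rewrite yE; under eq_Rintegral do rewrite weight_mul.
  by rewrite -/(moment theta) -hX hpE mulKf// gt_eqF.
move=> eta; rewrite yE ler_pdivrMl//.
have [h'0|h'0] := eqVneq (Lp_width eta) 0.
  have [c c0 /(_ eta)] := Lp_width_coercive.
  rewrite h'0 pmulr_rle0// => Se.
  have eta0 : eta = 0.
    apply/rowP => i; rewrite mxE; apply/eqP; rewrite -normr_le0.
    apply: le_trans Se; rewrite (bigD1 i)//= lerDl.
    by apply: sumr_ge0.
  rewrite mulr0 (@eq_Rintegral _ _ _ mu K (cst 0)); first by rewrite Rintegral_cst// mul0r.
  by move=> x _; rewrite eta0 dotvC dotv0l mulr0.
have h'pos : 0 < Lp_width eta by rewrite lt_neqAle eq_sym h'0 Lp_width_ge0.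
set h' := Lp_width eta in h'0 h'pos *.
have h'X : h' `^ p = moment eta by exact: Lp_widthX.
pose c1 := h `^ (p - 1) * h' * (1 - p^-1) / h `^ p.
pose c2 := h `^ (p - 1) * h' * p^-1 / h' `^ p.
have ptw x : weight theta x * dotv x eta <=
    c1 * `|dotv x theta| `^ p + c2 * `|dotv x eta| `^ p.
  apply: le_trans (ler_norm _) _; rewrite normrM.
  apply: le_trans (ler_wpM2r (normr_ge0 _) (weight_norm _ _)) _.
  move: (normr_ge0 (dotv x theta)) (normr_ge0 (dotv x eta)).
  by move=> u0 v0; exact: weighted_young.
have ->: h `^ (p - 1) * h' = c1 * moment theta + c2 * moment eta.
  rewrite /c1 /c2 -hX -h'X.
  have alg (a b u v : R) : 0 < u -> 0 < v ->
      a * b = a * b * (1 - p^-1) / u * u + a * b * p^-1 / v * v.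
    by move=> u0 v0; field; rewrite !gt_eqF.
  by apply: alg; rewrite powR_gt0.
have iZ c eta' : mu.-integrable K (EFin \o (fun x => c * `|dotv x eta'| `^ p)).
  have : mu.-integrable K (fun x => c%:E * (EFin \o (fun x => (`|dotv x eta'| `^ p)%R)) x)%E.
    by apply: integrableZl => //; exact: integrable_moment.
  by apply: eq_integrable.
have -> : c1 * moment theta + c2 * moment eta =
    \int[mu]_(x in K) (c1 * `|dotv x theta| `^ p + c2 * `|dotv x eta| `^ p).
  rewrite RintegralD; [|exact: mK|exact: iZ|exact: iZ].
  rewrite RintegralZl; [|exact: mK|exact: integrable_moment].
  by rewrite RintegralZl; [|exact: mK|exact: integrable_moment].
apply: le_Rintegral => //.
- have [M M0 SM] := width_bounded eta r0 Kr.
  by apply: (@integrable_weight theta _ M) => //; exact: measurable_dotv.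
- have := integrableD mK (iZ c1 theta) (iZ c2 eta).
  by apply: eq_integrable.
Qed.

Lemma contact_point_exists theta : exists2 y, centroid_set y & dotv theta y = Lp_width theta.
Proof.
have [h0|h0] := eqVneq (Lp_width theta) 0; last first.
  by apply: contact_point; rewrite lt_neqAle eq_sym h0 Lp_width_ge0.
exists 0; last by rewrite h0 dotvC dotv0l.
by move=> eta; rewrite dotvC dotv0l Lp_width_ge0.
Qed.

Lemma centroid_set_convex : @convex_set R 'rV[R]_n centroid_set.
Proof.
move=> x y t; rewrite !inE => Cx Cy theta.
change (dotv theta (t%:num *: x + (1 - t%:num) *: y) <= Lp_width theta).
have t0 : 0 <= t%:num by []. 
have t1 : 0 <= 1 - t%:num by rewrite subr_ge0.
rewrite dotvDr !dotvZr (_ : Lp_width theta = t%:num * Lp_width theta + (1 - t%:num) * Lp_width theta).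
  by apply: lerD; apply: ler_wpM2l.
by ring.
Qed.

Lemma centroid_set_compact : compact centroid_set.
Proof.
apply: bounded_closed_compact; last first.
  rewrite (_ : centroid_set = \bigcap_theta [set y | dotv y theta <= Lp_width theta]).
    apply: closed_bigI => theta _.
    apply: (@preimage_closed _ _ (dotv ^~ theta) [set u | u <= Lp_width theta]).
      by move=> y _; exact: dotv_continuous.
    exact: closed_le.
  apply/seteqP; split=> y Cy theta; first by move=> _; rewrite /= dotvC; exact: Cy.
  by rewrite dotvC; exact: (Cy theta I).
pose B := \sum_i (Lp_width (delta_mx ord0 i) + Lp_width (- delta_mx ord0 i)).
have B0 : 0 <= B by apply: sumr_ge0 => i _; rewrite addr_ge0 ?Lp_width_ge0.
exists B; split; first exact: num_real.
move=> N BN y Cy; apply: (le_trans _ (ltW BN)).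
rewrite [`|_|]mx_normrE; apply/bigmax_leP; split=> // -[i j] _ /=; rewrite ord1.
have yj : y ord0 j = dotv (delta_mx ord0 j) y.
  rewrite /dotv (bigD1 j)//= mxE !eqxx mul1r big1 ?addr0// => k /negPf kj.
  by rewrite mxE kj andbF mul0r.
apply: (@le_trans _ _ (Lp_width (delta_mx ord0 j) + Lp_width (- delta_mx ord0 j))).
  rewrite ler_norml yj; have := Cy (- delta_mx ord0 j); have := Cy (delta_mx ord0 j).
  rewrite dotvNl; have := Lp_width_ge0 (delta_mx ord0 j).
  have := Lp_width_ge0 (- delta_mx ord0 j).
  by move: (dotv _ y) (Lp_width _) (Lp_width _) => a b c; lra.
rewrite /B (bigD1 j)//= lerDl; apply: sumr_ge0 => i' _.
by rewrite addr_ge0 ?Lp_width_ge0.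
Qed.

Lemma centroid_set_interior : interior centroid_set !=set0.
Proof.
have [c c0 cw] := Lp_width_coercive.
exists 0; apply/nbhs_ballP; exists c => //= y.
rewrite mx_norm_ball /ball_/= sub0r normrN => yc theta.
apply: le_trans (cw theta); rewrite mulr_sumr; apply: ler_sum => i _.
apply: (le_trans (ler_norm _)); rewrite normrM mulrC ler_wpM2r//.
apply: le_trans (ltW yc); rewrite [leRHS]mx_normrE; apply/bigmax_geP; right => /=.
by exists (ord0, i).
Qed.

Lemma centroid_bodyP : is_centroid_body p K (centroid_body p K).
Proof.
apply: (@xgetPex _ set0 [set C | is_centroid_body p K C]).
exists centroid_set; split.
  split; [exact: centroid_set_convex|exact: centroid_set_compact|exact: centroid_set_interior].
move=> theta; rewrite -/(Lp_width theta); apply/eqP; rewrite eq_le; apply/andP; split.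
  apply: support_function_le; last by move=> y; exact.
  by have [y Cy _] := contact_point_exists theta; exists y.
have [y Cy <-] := contact_point_exists theta.
exact: support_function_ge centroid_set_compact Cy.
Qed.

End centroid.

(** * Comparison with the floating body *)

Section comparison.
Context {R : realType} {n : nat}.
Variables (K : set 'rV[R]_n) (delta : R).
Hypotheses (bK : convex_body K) (sK : zero_symmetric K) (K1 : lebesgue_rV n K = 1%:E).
Hypotheses (d0 : 0 < delta) (de : delta <= (expR 1)^-1).
Local Notation mu := (lebesgue_rV n).
Local Notation p := (ln delta^-1).

Let cK : @convex_set R 'rV[R]_n K. Proof. by case: bK. Qed.
Let cptK : compact K. Proof. by case: bK. Qed.

Lemma convex_body_measurable : measurable K.
Proof. by apply: closed_measurable_rV; apply: compact_closed => //; exact: norm_hausdorff. Qed.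

Lemma zero_symmetricN x : K x -> K (- x).
Proof. by move=> Kx; rewrite sK; exists x. Qed.

Lemma convex_body_sub_cube : exists2 r : R, 0 <= r & K `<=` cube r.
Proof.
have [M [_ KM]] := compact_bounded cptK.
exists (`|M| + 1); first by rewrite addr_ge0.
move=> x Kx i; have := KM (`|M| + 1) _ x Kx; rewrite ltr_pwDr ?ler_norm// => /(_ isT).
apply: le_trans; rewrite [leRHS]mx_normrE; apply/bigmax_geP; right => /=.
by exists (ord0, i).
Qed.

(** If K contains x0 + v and x0 - v, then by symmetry it contains v - x0, and v is
    the midpoint of x0 + v and v - x0. *)
Lemma cube_sub_convex_body : exists2 rho : R, 0 < rho & cube rho `<=` K.
Proof.
have [_ _ [x0 /nbhs_ballP[e /= e0 eK]]] := bK.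
exists (e / 2); first by rewrite divr_gt0.
move=> v ve.
have ball_v (w : 'rV[R]_n) : cube (e / 2) w -> K (x0 + w).
  move=> we; apply: eK; rewrite mx_norm_ball /ball_/= opprD addNKr normrN.
  rewrite [ltLHS]mx_normrE; apply/bigmax_ltP; split => // -[i j] _ /=; rewrite ord1.
  by apply: (le_lt_trans (we j)); rewrite ltr_pdivrMr// ltr_pMr// ltr1n.
have Kv := ball_v _ ve.
have /zero_symmetricN KNv : K (x0 + - v).
  by apply: ball_v => i; rewrite mxE normrN; exact: ve.
have := convex_midpoint cK Kv KNv.
rewrite (_ : 2^-1 *: _ = v)//; apply/rowP => i; rewrite !mxE; lra.
Qed.

Let p1 : 1 <= p.
Proof.
rewrite -[leLHS](expRK (1 : R)) ler_ln ?posrE ?expR_gt0 ?invr_gt0//.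
by rewrite -[leLHS]invrK lef_pV2 ?posrE ?invr_gt0 ?expR_gt0.
Qed.

Let expRNp : expR (- p) = delta.
Proof. by rewrite lnV ?posrE// opprK lnK ?posrE. Qed.

Let delta_lt1 : delta < 1.
Proof.
apply: (le_lt_trans de); rewrite invf_lt1 ?expR_gt0//.
by apply: lt_le_trans (expR1_ge94); lra.
Qed.

Local Notation h := (Lp_width K p).

Lemma unit_sphere_neq0 (theta : 'rV[R]_n) : unit_sphere theta -> theta != 0.
Proof.
rewrite /unit_sphere/=; apply: contraPneq => ->.
by rewrite dotv0l; apply/eqP; rewrite eq_sym oner_eq0.
Qed.

(** Both bounds hold at every level t of the set whose supremum is the slab width;
    the lower one needs in addition that this set is not empty. *)
Lemma slab_width_bounds theta : unit_sphere theta ->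
  h theta / 150 <= slab_width delta K theta <= expR 1 * h theta.
Proof.
move=> uth; have th0 := unit_sphere_neq0 uth.
have mK := convex_body_measurable.
have [r r0 Kr] := convex_body_sub_cube.
have p0 : 0 < p by exact: lt_le_trans p1.
pose T := [set t | 0 < t /\ mu (slab K theta t) = (1 - delta)%:E].
have sT : slab_width delta K theta = sup T by [].
have Tle t : T t -> t <= expR 1 * h theta.
  move=> [t0 mt]; have := slab_tail theta mK K1 t; rewrite mt /= => tl.
  have tl' : fine (mu (tail K theta t)) = expR (- p) by rewrite expRNp; lra.
  have := markov_width theta mK r0 Kr K1 t0 (ltW p0); rewrite tl' => mkv.
  rewrite -ler_pdivrMl ?expR_gt0// -expRN.
  rewrite (_ : expR (- 1) * t = (t `^ p * expR (- p)) `^ p^-1).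
    apply: le_powR2 => //; first by rewrite invr_ge0 ltW.
    by rewrite mulr_ge0 ?powR_ge0 ?expR_ge0.
  rewrite powRM ?powR_ge0 ?expR_ge0// -powRrM divff ?gt_eqF// powRr1 ?(ltW t0)//.
  rewrite mulrC; congr (_ * _); rewrite /powR gt_eqF ?expR_gt0// expRK mulrN mulVf//.
  by rewrite gt_eqF.
have v01 : 0 < 1 - delta < 1 by apply/andP; split; [rewrite subr_gt0|rewrite gtrBl].
have [t t0 vt] := slab_attains mK r0 Kr K1 th0 v01.
have Tt : T t.
  split=> //; rewrite -vt fineK// ge0_fin_numE//; exact: slab_finite.
have hT : has_sup T by split; [exists t|exists (expR 1 * h theta) => ? /Tle].
rewrite sT; apply/andP; split; last by apply: sup_le_ub; [exists t|exact: Tle].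
apply: le_trans (sup_upper_bound hT Tt).
have := @moment_le _ _ K theta r mK r0 Kr cK K1 t p t0 p1; rewrite expRNp => /(_ vt) mom.
rewrite ler_pdivrMr// mulrC.
rewrite -[leRHS](@powRK _ _ p^-1) ?invr_eq0 ?gt_eqF// ?invrK; last by rewrite mulr_ge0// ltW.
apply: le_powR2; [by rewrite invr_ge0 ltW|exact: moment_ge0|exact: mom].
Qed.

Lemma Lp_width_le_support theta : h theta <= support_function K theta.
Proof.
have mK := convex_body_measurable.
have [r r0 Kr] := convex_body_sub_cube.
have p0 : 0 < p by exact: lt_le_trans p1.
have Ks x : K x -> `|dotv x theta| <= support_function K theta.
  move=> Kx; rewrite ler_norml lerNl -dotvNl ![dotv _ theta]dotvC.
  by apply/andP; split; apply: support_function_ge => //; exact: zero_symmetricN.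
have [x Kx] : K !=set0 by have [_ _ [x /interior_subset Kx]] := bK; exists x.
have s0 : 0 <= support_function K theta by exact: le_trans (normr_ge0 _) (Ks x Kx).
set s := support_function K theta in Ks s0 *.
rewrite -[leRHS](@powRK _ _ p^-1) ?invr_eq0 ?gt_eqF// ?invrK.
apply: le_powR2; [by rewrite invr_ge0 ltW|exact: moment_ge0|].
have muKfin : (mu K < +oo)%E by rewrite K1 ltry.
have -> : s `^ p = \int[mu]_(x in K) (cst (s `^ p) x).
  by rewrite Rintegral_cst// [X in _ * X](congr1 fine K1) mulr1.
apply: le_Rintegral; first exact: mK.
- by apply: (powR_width_integrable theta mK r0 Kr K1) => //; exact: ltW.
- exact: (bounded_integrable (M := `|s `^ p|)).
- by move=> y Ky; apply: le_powR2 => //; [exact: ltW|exact: Ks].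
Qed.

Local Notation Z := (centroid_body p K).
Local Notation Kd := (floating_body delta K).

Let ZP : is_centroid_body p K Z.
Proof.
have mK := convex_body_measurable.
have [r r0 Kr] := convex_body_sub_cube.
have [rho rho0 rhoK] := cube_sub_convex_body.
exact: (centroid_bodyP mK r0 Kr K1 rho0 rhoK p1).
Qed.

Let ZE theta : support_function Z theta = h theta. Proof. by case: ZP. Qed.
Let cptZ : compact Z. Proof. by case: ZP => -[]. Qed.
Let cZ : @convex_set R 'rV[R]_n Z. Proof. by case: ZP => -[]. Qed.
Let Z0 : Z !=set0.
Proof. by have [[_ _ [x /interior_subset Zx]] _] := ZP; exists x. Qed.
Let K0 : K !=set0.
Proof. by have [_ _ [x /interior_subset Kx]] := bK; exists x. Qed.

Lemma dilate_centroid_sub_floating : dilate 150^-1 Z `<=` Kd.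
Proof.
move=> _ [z Zz <-].
have zh theta : dotv theta z <= h theta by rewrite -ZE; exact: support_function_ge.
have h0 theta : 0 <= h theta by exact: Lp_width_ge0.
have hN theta : h (- theta) = h theta.
  suff mN : moment K p (- theta) = moment K p theta by rewrite /Lp_width mN.
  by apply: eq_Rintegral => x _; rewrite dotvNr normrN.
have Kz : K (150^-1 *: z).
  apply: in_convex_body => // theta _; rewrite dotvZr.
  apply: le_trans (Lp_width_le_support theta).
  by have := zh theta; have := h0 theta; move: (h theta) (dotv _ _) => a b; lra.
move=> theta uth; split=> //.
have /andP[lo _] := slab_width_bounds uth; apply: le_trans lo.
rewrite dotvZl normrM ger0_norm ?invr_ge0// mulrC ler_pM2r; last by rewrite invr_gt0.
rewrite dotvC ler_norml lerNl -dotvNl; apply/andP; split; last exact: zh.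
by apply: le_trans (zh (- theta)) _; rewrite hN.
Qed.

Lemma floating_sub_dilate_centroid : Kd `<=` dilate (expR 1) Z.
Proof.
move=> x Kdx; have e0 := expR_gt0 (1 : R).
exists ((expR 1)^-1 *: x); last by rewrite scalerA divff ?scale1r// gt_eqF.
apply: in_convex_body => // theta uth; rewrite ZE dotvZr ler_pdivrMl//.
have [_ /= xw] := Kdx theta uth.
have /andP[_ hi] := slab_width_bounds uth; apply: le_trans hi.
by apply: le_trans xw; rewrite dotvC; exact: ler_norm.
Qed.

Lemma floating_support_bounds theta : unit_sphere theta ->
  150^-1 * support_function Z theta <= support_function Kd theta
    <= expR 1 * support_function Z theta.
Proof.
move=> uth.
have Kdw y : Kd y -> dotv theta y <= slab_width delta K theta.
  by move=> /(_ theta uth)[_ /= yw]; apply: le_trans yw; rewrite dotvC ler_norm.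
have Kd0 : Kd !=set0.
  have [z Zz] := Z0; exists (150^-1 *: z).
  by apply: dilate_centroid_sub_floating; exists z.
have /andP[_ hi] := slab_width_bounds uth.
apply/andP; split; last first.
  by apply: support_function_le => // y Ky; rewrite ZE; apply: le_trans (Kdw y Ky) hi.
rewrite ler_pdivrMl//; apply: support_function_le => // y Zy.
rewrite -ler_pdivrMl// -dotvZr; apply: sup_upper_bound; last first.
  by exists (150^-1 *: y) => //; apply: dilate_centroid_sub_floating; exists y.
have [y0 Kdy0] := Kd0; split; first by exists (dotv theta y0), y0.
by exists (slab_width delta K theta) => _ [w /Kdw ? <-].
Qed.

End comparison.

Lemma polar_dilate {R : realType} {n : nat} (c : R) (A B : set 'rV[R]_n) : 0 < c ->
  A `<=` dilate c B -> dilate c^-1 (polar B) `<=` polar A.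
Proof.
move=> c0 AB _ [y By <-] x /AB[b Bb <-].
by rewrite dotvZl dotvZr mulrA divff ?gt_eqF// mul1r; exact: By.
Qed.

Lemma dilate_polar {R : realType} {n : nat} (c : R) (A B : set 'rV[R]_n) : 0 < c ->
  dilate c B `<=` A -> polar A `<=` dilate c^-1 (polar B).
Proof.
move=> c0 BA y Ay; exists (c *: y); last by rewrite scalerA mulVf ?scale1r// gt_eqF.
by move=> b Bb; rewrite dotvZr -dotvZl; apply: Ay; apply: BA; exists b.
Qed.

Theorem theorem2p2 (R : realType) :
  exists c1 c2 : R, [/\ 0 < c1, 0 < c2 &
    forall (n : nat) (K : set 'rV[R]_n) (delta : R),
      convex_body K -> zero_symmetric K -> lebesgue_rV n K = 1%:E ->
      0 < delta -> delta <= (expR 1)^-1 ->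
      let Z := centroid_body (ln delta^-1) K in
      let Kd := floating_body delta K in
      [/\ forall theta, unit_sphere theta ->
            c1 * support_function Z theta <= support_function Kd theta
              <= c2 * support_function Z theta,
          dilate c1 Z `<=` Kd /\ Kd `<=` dilate c2 Z &
          dilate c2^-1 (polar Z) `<=` polar Kd /\
            polar Kd `<=` dilate c1^-1 (polar Z)]].
Proof.
exists 150^-1, (expR 1); split; [by rewrite invr_gt0|exact: expR_gt0|].
move=> n K delta bK sK K1 d0 de Z Kd.
have ZKd := dilate_centroid_sub_floating bK sK K1 d0 de.
have KdZ := floating_sub_dilate_centroid bK sK K1 d0 de.
split; first by move=> theta; exact: floating_support_bounds.
  by split.
split; first by apply: polar_dilate; [exact: expR_gt0|].
by apply: dilate_polar; [rewrite invr_gt0|].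
Qed.
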